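(* Let $n \geq \omega > \xi \geq 1$ be integers with $\xi^{1/2}\omega \le 8n/\log n$. Assume $\delta < 1$ and let $(\pi_{\mathbf s}, \Delta_{\mathbf s})_{\mathbf s}$ be a $\delta$-random resolution refutation distribution of $Clique_{n,\omega} \cup Color_{n,\xi}$ with $k$ clauses. Put $d := \max_{\mathbf s} |\Delta_{\mathbf s}|$. Then: (1) If $d\delta < 1$ then $k \geq (1 - d\delta^{1/2})\, n^{\Omega(\xi^{1/2})}$. (2) $k \geq \min\left(1/(2\delta^{1/2}),\ n^{\Omega(\xi^{1/2})}\right)$.
   Context: Write $[m]:=\{1,\dots,m\}$. The clause set $Clique_{n,\omega}\cup Color_{n,\xi}$ uses three disjoint sets of propositional variables: $\mathbf p=(p_{ij})$, indexed by the $\binom n2$ unordered pairs of different elements $i,j\in[n]$; $\mathbf q=(q_{ui})$ with $(u,i)\in[\omega]\times[n]$; and $\mathbf r=(r_{iv})$ with $(i,v)\in[n]\times[\xi]$. A clause is a finite set of literals, understood as their disjunction. $Clique_{n,\omega}$ consists of the clauses: - $\{q_{u1},\dots,q_{un}\}$ for each $u\in[\omega]$; - $\{\neg q_{ui},\neg q_{vi}\}$ for $u\ne v\in[\omega]$ and $i\in[n]$; - $\{\neg q_{ui},\neg q_{vj},p_{ij}\}$ for $u\neq v\in[\omega]$ and $i\neq j\in[n]$. $Color_{n,\xi}$ consists of the clauses: - $\{r_{i1},\dots,r_{i\xi}\}$ for each $i\in[n]$; - $\{\neg r_{iu},\neg r_{iv}\}$ for $u\neq v\in[\xi]$ and $i\in[n]$;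 - $\{\neg r_{iv},\neg r_{jv},\neg p_{ij}\}$ for $v\in[\xi]$ and $i\neq j\in[n]$. A $\delta$-random resolution refutation distribution of a set of clauses $\Psi$ is a random distribution $(\pi_{\mathbf s},\Delta_{\mathbf s})_{\mathbf s}$ (with $\mathbf s$ the random sample) such that each $\Delta_{\mathbf s}$ is a set of clauses, each $\pi_{\mathbf s}$ is a resolution refutation of $\Psi\cup\Delta_{\mathbf s}$, and any fixed truth assignment to all variables satisfies the set of clauses $\Delta_{\mathbf s}$ (i.e. all clauses in it) with probability at least $1-\delta$ over $\mathbf s$. The number of clauses of such a random refutation is the maximal number of clauses among all $\pi_{\mathbf s}$; $|\Delta_{\mathbf s}|$ is the number of clauses in $\Delta_{\mathbf s}$. The notation $n^{\Omega(\xi^{1/2})}$ stands for $n^{c\,\xi^{1/2}}$ with an absolute constant $c>0$, independent of $n,\omega,\xi,\delta$ and of the refutation distribution. *)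

(* Defs.v *)
From HB Require Import structures.
From mathcomp Require Import all_boot all_order all_algebra.
From mathcomp Require Import all_classical all_reals all_analysis.

Set Implicit Arguments.
Unset Strict Implicit.
Unset Printing Implicit Defensive.

Import Order.TTheory GRing.Theory Num.Theory.

Local Open Scope ring_scope.

(* Clauses are sets of literals, so contraction is built in.  Tautological
   clauses (containing both a variable and its negation) are allowed. *)
Section Resolution.
Variable V : finType.

(* (true, x) is the literal x, and (false, x) its negation. *)
Definition literal : finType := (bool * V)%type.
Definition clause : finType := {set literal}.

Definition empty_clause : clause := finset.set0.

Definition pos (x : V) : literal := (true, x).
Definition neg (x : V) : literal := (false, x).

Definition assignment := {ffun V -> bool}.

Definition sat_clause (a : assignment) (C : clause) : bool :=
  [exists l in C, a l.2 == l.1].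

Definition sat (a : assignment) (D : {set clause}) : bool :=
  [forall C in D, sat_clause a C].

(* From C' \cup {x} and D' \cup {~x} infer C' \cup D'.  It is not required
   that x be absent from C' or its negation from D', so a premise may keep a
   copy of the literal resolved upon. *)
Definition resolvent (C D E : clause) : Prop :=
  exists (x : V) (C' D' : clause),
    [/\ C = (pos x |: C')%SET, D = (neg x |: D')%SET & E = (C' :|: D')%SET].

Definition resolution_refutation (Psi : {set clause}) (pi : seq clause) : Prop :=
  (exists pi' : seq clause, pi = rcons pi' empty_clause) /\
  forall i : nat, (i < size pi)%N ->
    nth empty_clause pi i \in Psi \/
    exists j k : nat, [/\ (j < i)%N, (k < i)%N &
      resolvent (nth empty_clause pi j) (nth empty_clause pi k)
                (nth empty_clause pi i)].

Record random_resolution_refutation (R : realType) (dT : measure_display)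
    (T : measurableType dT) (P : probability T R) (delta : R)
    (Psi : {set clause}) (pi : T -> seq clause) (Delta : T -> {set clause}) :
    Prop := RandomResolutionRefutation {
  rrr_measurable : forall a : assignment,
    measurable ([set s | sat a (Delta s)]%classic : set T);
  rrr_refutation : forall s : T,
    resolution_refutation (Psi :|: Delta s)%SET (pi s);
  rrr_sat : forall a : assignment,
    ((1 - delta)%:E <= P [set s | sat a (Delta s)]%classic)%E }.

End Resolution.

Definition is_max (T : Type) (f : T -> nat) (m : nat) : Prop :=
  (exists s : T, f s = m) /\ (forall s : T, (f s <= m)%N).

Section CliqueColor.
Variables n omega xi : nat.

Definition upair : finType := {e : {set 'I_n} | #|e| == 2%N}.

Definition var : finType := (upair + 'I_omega * 'I_n + 'I_n * 'I_xi)%type.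

Definition pvar (e : upair) : var := inl (inl e).
Definition qvar (u : 'I_omega) (i : 'I_n) : var := inl (inr (u, i)).
Definition rvar (i : 'I_n) (v : 'I_xi) : var := inr (i, v).

Definition clique : {set clause var} := ([set C : clause var |
  [|| [exists u : 'I_omega, C == [set pos (qvar u i) | i : 'I_n]],
      [exists u : 'I_omega, exists v : 'I_omega, exists i : 'I_n,
         (u != v) && (C == [set neg (qvar u i); neg (qvar v i)])]
    | [exists u : 'I_omega, exists v : 'I_omega,
       exists i : 'I_n, exists j : 'I_n, exists e : upair,
         [&& u != v, i != j, val e == [set i; j] &
             C == [set neg (qvar u i); neg (qvar v j); pos (pvar e)]]]]])%SET.

Definition color : {set clause var} := ([set C : clause var |
  [|| [exists i : 'I_n, C == [set pos (rvar i v) | v : 'I_xi]],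
      [exists u : 'I_xi, exists v : 'I_xi, exists i : 'I_n,
         (u != v) && (C == [set neg (rvar i u); neg (rvar i v)])]
    | [exists v : 'I_xi,
       exists i : 'I_n, exists j : 'I_n, exists e : upair,
         [&& i != j, val e == [set i; j] &
             C == [set neg (rvar i v); neg (rvar j v); neg (pvar e)]]]]])%SET.

End CliqueColor.

Definition log2 (R : realType) (x : R) : R := ln x / ln 2.

(* Main.v *)
Require Import Defs.
From mathcomp Require Import all_boot all_order all_algebra.
From mathcomp Require Import all_classical all_reals all_analysis.
From mathcomp Require Import zify ring lra.

(** Fix a function f from the rows u of the clique to vertices and a colouring chi
    of the vertices, and read off an assignment: q_ui says that f u = i, r_iv says
    that chi i = v, and p_e says that the edge e is not monochromatic.  Such an
    assignment satisfies every clause of Color and violates Clique only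
    at two rows u, v with chi (f u) = chi (f v).  It falsifies a clause C exactly when
    f lies in a box, the product over u of the sets [places C u], and chi falsifies
    the literals on p and r, which is [color_false C chi].  Following falsified
    clauses backwards through a refutation ends in a clause of Clique or in an added clause;
    the proof shows that a short refutation cannot lead all the pairs (f, chi) there.

    The placements are controlled by the polynomial method.  Given degrees D u, a list
    of boxes whose relative sizes (the products over u of min(|c u|, D u) / D u) add up
    to less than 1 can be avoided by a polynomial of degree less than D u in the
    coordinate u.  The set G of placements where it does not vanish is nonempty, misses
    all the boxes, and is closed along lines: if f is in G and B is a set of at
    least D u vertices, then some i in B can be put at u without leaving G
    ([line_closed_avoidance]).

    Call the row u pinned in C when C leaves fewer than D u + T places for it.
    The invariant carried through the refutation is that every f in G inside the
    box of C is caught by C: two pinned rows share a vertex, or the set X of vertices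
    occupied by the pinned rows is dead for C.  A clause of Clique
    pins two rows and forces their colours to agree.  Resolving on a variable q_ui
    whose row is not pinned in the conclusion is harmless: line closure moves f u to
    a fresh vertex that does not make X dead ([caught_everywhere]).  For the
    empty clause the invariant says that the empty set is dead ([Dead_root]).

    Death comes from counting colourings.  X is nogood for C when all the
    colourings that falsify C and are injective on X lie in a fixed set bad.
    The set bad is saturated: a family of colourings of this kind that is not inside
    bad exceeds it by a fraction more than 2^-r of all colourings.  Plucking then
    says that r disjoint small sets Z for which W :|: Z is nogood already make W nogood,
    since a random colouring that is injective on W fails to be injective on each W :|: Z
    with probability at most 1/2, independently enough to multiply ([pluck],
    [nogood_pluck]).  If xi is large, dead can mean nogood ([dense_contradiction]).
    If xi is small, the pinned rows occupy far more than sqrt xi vertices; dead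
    then means that some nogood subset has at most l ~ sqrt xi elements, and the
    placements for which this notion is not stable under unions contain one of few chains
    of l prescribed values, which are boxes and can be avoided as well
    ([kernel_of_nogood], [sparse_contradiction]).

    Two kinds of boxes have to be avoided.  Clauses with too many pinned rows have small
    boxes when the degrees of the rows are chosen at random among about n, n/2 and n/4
    ([exists_levels]).  The clauses added at random are dealt with by averaging:
    in some sample, the added clauses hold under all but a fraction delta of the
    assignments built from a random colouring and random sparse rows.  In that sample
    each added clause is falsified only by colourings from a small set, or no placement
    falsifies it, or it contains literals not q_ui in so many different rows that its box
    is small compared with sqrt delta ([handled_random]).  A single
    added clause needs no averaging ([handled_single]).

    Altogether a refutation of size k has k^48 >= n^l with l ~ (xi/12)^(1/2)
    ([no_short_refutation]).  When xi is bounded by a constant, the bound k > n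
    suffices ([more_clauses_than_vertices]). *)

Set Implicit Arguments.
Unset Strict Implicit.
Unset Printing Implicit Defensive.

Import Order.TTheory GRing.Theory Num.Theory.

Local Open Scope ring_scope.


(** * The polynomial method: avoiding boxes by a line-closed set *)

Section Avoid.
Variables m n : nat.
Implicit Types (f : {ffun 'I_m -> 'I_n}) (u v : 'I_m) (i : 'I_n).

Definition upd f u i : {ffun 'I_m -> 'I_n} :=
  [ffun v => if v == u then i else f v].

Lemma upd_id f u : upd f u (f u) = f.
Proof. by apply/ffunP => v; rewrite ffunE; case: eqP => // ->. Qed.

Lemma upd_eq f u i : upd f u i u = i.
Proof. by rewrite ffunE eqxx. Qed.

Lemma upd_neq f u i v : v != u -> upd f u i v = f v.
Proof. by rewrite ffunE => /negbTE->. Qed.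

Definition in_cube (c : 'I_m -> {set 'I_n}) f := [forall u, f u \in c u].

(** The Lagrange basis polynomial for the nodes 0, ..., D - 1 and the node a. *)
Definition nodal (D a : nat) : {poly rat} :=
  \prod_(b < D | (b : nat) != a)
     ((a%:R - b%:R)^-1 *: ('X - (b%:R)%:P)).

Lemma size_nodal (D a : nat) : (a < D)%N -> (size (nodal D a) <= D)%N.
Proof.
move=> aD; rewrite /nodal.
have H : forall b : 'I_D, (b : nat) != a ->
    (size ((a%:R - b%:R : rat)^-1 *: ('X - (b%:R : rat)%:P))).-1 = 1%N.
  move=> b ba; rewrite size_scale ?size_XsubC //.
  by rewrite invr_eq0 subr_eq0 eqr_nat eq_sym.
rewrite size_prod; last first.
  move=> b ba; rewrite scaler_eq0 polyXsubC_eq0 orbF.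
  by rewrite invr_eq0 subr_eq0 eqr_nat eq_sym.
have -> : (\sum_(b < D | (b : nat) != a)
    size ((a%:R - b%:R : rat)^-1 *: ('X - (b%:R : rat)%:P)) =
    \sum_(b < D | (b : nat) != a) 2)%N.
  apply: eq_bigr => b ba; rewrite size_scale ?size_XsubC //.
  by rewrite invr_eq0 subr_eq0 eqr_nat eq_sym.
rewrite sum_nat_const.
have -> : #|[pred b : 'I_D | (b : nat) != a]| = D.-1.
  have := cardC1 (Ordinal aD); rewrite card_ord => <-.
  by apply: eq_card => b; rewrite !inE.
lia.
Qed.

Lemma horner_nodal (D a b : nat) : (a < D)%N -> (b < D)%N ->
  (nodal D a).[b%:R] = (a == b)%:R.
Proof.
move=> aD bD; rewrite /nodal horner_prod.
case: eqVneq => [<-|ab].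
  apply: big1 => c ca; rewrite hornerZ hornerXsubC mulVf //.
  by rewrite subr_eq0 eqr_nat eq_sym.
rewrite (bigD1 (Ordinal bD)) /= ?(eq_sym b) //.
by rewrite hornerZ hornerXsubC subrr mulr0 mul0r.
Qed.

Lemma line_polynomial_nonvanishing (p : {poly rat}) (D : nat) (B : {set 'I_n}) :
  p != 0 -> (size p <= D)%N -> (D <= #|B|)%N ->
  exists2 i, i \in B & p.[(i : nat)%:R] != 0.
Proof.
move=> p0 pD DB; apply/exists_inP; apply: contraT; rewrite negb_exists_in.
move=> /forall_inP H.
have := @max_poly_roots _ p [seq (i : nat)%:R | i <- enum B] p0.
rewrite size_map -cardE => F.
suff : (#|B| < size p)%N by lia.
apply: F.
  apply/allP => x /mapP[i iB ->]; rewrite rootE -[_ == _]negbK.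
  by apply: H; rewrite -mem_enum.
rewrite map_inj_uniq ?enum_uniq // => i j /eqP; rewrite eqr_nat => /eqP.
exact: val_inj.
Qed.

(** More unknowns than equations: this produces a nonzero polynomial that vanishes at
    all prescribed points. *)
Lemma left_kernel_vector (k N : nat) (M : 'M[rat]_(k, N)) :
  (N < k)%N -> exists2 v : 'rV[rat]_k, v != 0 & v *m M = 0.
Proof.
move=> Nk; have : kermx M != 0.
  by rewrite -mxrank_eq0 mxrank_ker; have := rank_leq_col M; lia.
move=> K0; exists (nz_row (kermx M)); first by rewrite nz_row_eq0.
by apply: sub_kermxP; apply: nz_row_sub.
Qed.

Lemma card_cube (c : 'I_m -> {set 'I_n}) :
  #|[set f | in_cube c f]| = (\prod_u #|c u|)%N.
Proof.
have -> : #|[set f | in_cube c f]| = #|family (fun u => mem (c u))|.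
  by apply: eq_card => f; rewrite inE.
by rewrite card_family foldrE big_map big_enum.
Qed.

Section Degree.
Variables (D : 'I_m -> nat).
Hypothesis Dn : forall u, (D u <= n)%N.

Definition low u : {set 'I_n} := [set i : 'I_n | (i < D u)%N].

Lemma card_low u : #|low u| = D u.
Proof.
rewrite -sum1_card (eq_bigl (fun i : 'I_n => (i < D u)%N)).
  by rewrite (big_ord_narrow (Dn u)) sum1_card card_ord.
by move=> i; rewrite inE.
Qed.

Definition grid : {set {ffun 'I_m -> 'I_n}} := [set e | in_cube low e].

(** Evaluated at placements, these are the polynomials of degree less than D u in the
    coordinate u; h gives the values on the grid, which determine the polynomial. *)
Definition interpolant (h : {ffun 'I_m -> 'I_n} -> rat) f : rat :=
  \sum_(e in grid) h e * \prod_u (nodal (D u) (e u)).[(f u : nat)%:R].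

Lemma interpolant_grid h e : e \in grid -> interpolant h e = h e.
Proof.
move=> eE; rewrite /interpolant (bigD1 e) //= [X in _ + X]big1 ?addr0.
  rewrite big1 ?mulr1 // => u _; move: eE; rewrite inE => /forallP/(_ u).
  by rewrite inE => eu; rewrite horner_nodal // eqxx.
move=> e' /andP[].
rewrite !inE => /forallP e'E /eqP ne.
have [u eu] : exists u, e' u != e u.
  apply/existsP; apply: contra_notT ne; rewrite negb_exists => /forallP H.
  by apply/ffunP => u; apply/eqP; rewrite -[_ == _]negbK.
rewrite (bigD1 u) //= horner_nodal; last 2 first.
- by have := e'E u; rewrite inE.
- by move: eE; rewrite inE => /forallP/(_ u); rewrite inE.
have -> : ((e' u : nat) == e u) = false by apply/negbTE.
by rewrite mul0r mulr0.
Qed.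

(** Along the line of all f with the coordinate u free, the polynomial has degree less
    than D u, so it cannot vanish on D u points without vanishing on the whole line. *)
Lemma interpolant_line h f u (B : {set 'I_n}) :
  interpolant h f != 0 -> (D u <= #|B|)%N ->
  exists2 i, i \in B & interpolant h (upd f u i) != 0.
Proof.
move=> gf DB.
pose p := \sum_(e in grid)
  (h e * \prod_(v | v != u) (nodal (D v) (e v)).[(f v : nat)%:R])
    *: nodal (D u) (e u).
have pE i : interpolant h (upd f u i) = p.[(i : nat)%:R].
  rewrite /p horner_sum; apply: eq_bigr => e _.
  rewrite hornerZ (bigD1 u) //= upd_eq -mulrA; congr (_ * _).
  rewrite mulrC; congr (_ * _); apply: eq_bigr => v vu.
  by rewrite upd_neq.
have p0 : p != 0.
  by apply: contraNneq gf => p0; rewrite -(upd_id f u) pE p0 horner0.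
have pD : (size p <= D u)%N.
  apply: (leq_trans (size_sum _ _ _)); apply/bigmax_leqP => e.
  rewrite inE => /forallP/(_ u); rewrite inE => eD.
  by apply: (leq_trans (size_scale_leq _ _)); apply: size_nodal.
have [i iB pi] := line_polynomial_nonvanishing p0 pD DB.
by exists i => //; rewrite pE.
Qed.

(** It suffices that a polynomial vanishes on a part of each box with at most D u
    elements in the direction u, for then it vanishes on the box by the degree bound,
    one coordinate at a time.  The number of conditions is the left side of the
    hypothesis, and the right side is the number of coefficients. *)
Lemma line_closed_avoidance (cs : seq {ffun 'I_m -> {set 'I_n}}) :
  (\sum_(c <- cs) \prod_u minn #|c u| (D u) < \prod_u D u)%N ->
  exists G : {set {ffun 'I_m -> 'I_n}},
  [/\ exists f, f \in G,
      forall c f, c \in cs -> f \in G -> ~~ in_cube c f &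
      forall f u (B : {set 'I_n}), f \in G -> (D u <= #|B|)%N ->
        exists2 i, i \in B & upd f u i \in G].
Proof.
move=> small.
have shrink (S : {set 'I_n}) k :
    {S' : {set 'I_n} | S' \subset S & #|S'| = minn #|S| k}.
  exists [set:: take k (enum S)].
    by apply/fintype.subsetP => x; rewrite inE => /mem_take; rewrite mem_enum.
  rewrite cardsE (card_uniqP _) ?take_uniq ?enum_uniq // size_take_min -cardE.
  by rewrite minnC.
(* The part of the box on which the polynomial is made to vanish. *)
pose c' (c : {ffun 'I_m -> {set 'I_n}}) u := s2val (shrink (c u) (D u)).
pose pts := flatten [seq enum [set f | in_cube (c' c) f] | c <- cs].
have size_pts : (size pts < #|grid|)%N.
  rewrite /pts size_flatten /shape -map_comp sumnE big_map /=.
  rewrite (_ : #|grid| = \prod_u D u)%N; last first.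
    by rewrite card_cube; apply: eq_bigr => u _; rewrite card_low.
  apply: leq_ltn_trans small; rewrite leq_eqVlt; apply/orP; left.
  apply/eqP; apply: eq_bigr => c _.
  rewrite -cardE card_cube; apply: eq_bigr => u _.
  by rewrite /c'; case: (shrink (c u) (D u)).
have [f0 _] : exists f0, f0 \in grid.
  by apply/card_gt0P; apply: leq_ltn_trans size_pts.
pose M : 'M[rat]_(#|grid|, size pts) :=
  \matrix_(a < #|grid|, b < size pts) \prod_u
    (nodal (D u) ((enum_val a : {ffun 'I_m -> 'I_n}) u)).[(nth f0 pts b u : nat)%:R].
have [v v0 vM] := left_kernel_vector M size_pts.
pose h e : rat := \sum_(a < #|grid| | enum_val a == e) v 0 a.
have hE a : h (enum_val a) = v 0 a.
  rewrite /h (bigD1 a) //= big1 ?addr0 // => a' /andP[/eqP/enum_val_inj->].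
  by rewrite eqxx.
have gpts f : f \in pts -> interpolant h f = 0.
  move=> fp; have fi : (index f pts < size pts)%N by rewrite index_mem.
  have /matrixP/(_ 0 (Ordinal fi)) := vM; rewrite !mxE => <-.
  rewrite /interpolant big_enum_val /=; apply: eq_bigr => a _.
  by rewrite mxE hE /= nth_index.
exists [set f | interpolant h f != 0]; split.
- have [a va] : exists a, v 0 a != 0.
    apply/existsP; apply: contraNT v0; rewrite negb_exists => /forallP H.
    by apply/eqP/rowP => a; rewrite mxE; apply/eqP; rewrite -[_ == _]negbK.
  exists (enum_val a); rewrite inE interpolant_grid ?enum_valP //.
  by rewrite hE.
- move=> c f cs_c; rewrite inE => gf.
  apply/negP => /forallP fc.
  (* Push f into the smaller box, one coordinate after the other. *)
  suff H (s : seq 'I_m) : exists f', [/\ interpolant h f' != 0,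
      forall u, f' u \in c u & forall u, u \in s -> f' u \in c' c u].
    have [f' [gf' _ H']] := H (enum 'I_m).
    move/negP: gf'; apply; apply/eqP; apply: gpts; apply/flattenP.
    exists (enum [set f | in_cube (c' c) f]).
      by apply/mapP; exists c.
    by rewrite mem_enum inE; apply/forallP => u; apply: H'; rewrite mem_enum.
  elim: s => [|u s [f' [gf' f'c f's]]]; first by exists f.
  have c'c w : c' c w \subset c w by rewrite /c'; case: (shrink _ _).
  have c'card : #|c' c u| = minn #|c u| (D u).
    by rewrite /c'; case: (shrink _ _).
  have [cD|Dc] := leqP #|c u| (D u).
    have c'E : c' c u = c u.
      by apply/eqP; rewrite eqEcard c'c c'card (minn_idPl cD) /=.
    exists f'; split=> // w; rewrite inE => /orP[/eqP->|/f's //].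
    by rewrite c'E.
  have [i ic gi] : exists2 i, i \in c' c u & interpolant h (upd f' u i) != 0.
    by apply: interpolant_line => //; rewrite c'card leq_min (ltnW Dc) /=.
  exists (upd f' u i); split=> // w.
    have [->|wu] := eqVneq w u; last by rewrite upd_neq.
    by rewrite upd_eq (fintype.subsetP (c'c u)).
  have [->|wu] := eqVneq w u; first by rewrite upd_eq.
  by rewrite inE (negbTE wu) upd_neq //=; apply: f's.
- move=> f u B; rewrite inE => gf DB.
  by have [i iB gi] := interpolant_line gf DB; exists i; rewrite ?inE.
Qed.

End Degree.
End Avoid.

(** * Random colourings that are injective on given sets *)

(** Whenever a set B of the list exceeds the current E by little, add it to E.  Each set
    of the list is added at most once, so E does not grow by more than size Bs * eps / a.
    The factor a clears the denominator of the threshold eps / a. *)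
Lemma absorb_small_remainders (T : finType) (Bs : seq {set T}) (E0 : {set T})
    (a eps : nat) :
  exists E : {set T}, [/\ E0 \subset E, (a * #|E| <= a * #|E0| + size Bs * eps)%N &
    forall B, B \in Bs -> B \subset E \/ (eps < a * #|B :\: E|)%N].
Proof.
suff H k : forall E1 : {set T}, (count (fun B : {set T} => ~~ (B \subset E1)) Bs <= k)%N ->
    exists E : {set T}, [/\ E1 \subset E, (a * #|E| <= a * #|E1| + k * eps)%N &
      forall B, B \in Bs -> B \subset E \/ (eps < a * #|B :\: E|)%N].
  by apply: (H (size Bs)); apply: count_size.
elim: k => [|k IHk] E1 Hk.
  exists E1; split=> [//||B BBs]; first by rewrite addn0.
  left; apply: contraTT Hk => nB; rewrite -ltnNge -has_count.
  by apply/hasP; exists B.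
have [/allP ok|/allPn[B BBs]] :=
  boolP (all (fun B : {set T} => (B \subset E1) || (eps < a * #|B :\: E1|)%N) Bs).
  exists E1; split=> [//||B /ok/orP //]; first by rewrite leq_addr.
rewrite negb_or -leqNgt => /andP[nB small].
have [|E [E1E cE okE]] := IHk (E1 :|: B)%SET.
  rewrite -ltnS; apply: leq_trans Hk.
  have [s1 [s2 ->]] : exists s1 s2, Bs = s1 ++ B :: s2.
    by have [s1 s2] := path.splitPr BBs; exists s1, s2.
  have sub s : (count (fun B' : {set T} => ~~ (B' \subset E1 :|: B)) s <=
                count (fun B' : {set T} => ~~ (B' \subset E1)) s)%N.
    apply: sub_count => B'; apply: contra => /fintype.subset_trans; apply.
    exact: finset.subsetUl.
  rewrite !count_cat /= nB finset.subsetUr add0n add1n addnS ltnS.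
  by apply: leq_add.
exists E; split=> //; first by apply: fintype.subset_trans E1E; apply: finset.subsetUl.
apply: (leq_trans cE); rewrite mulSn addnA leq_add2r.
have -> : (E1 :|: B = E1 :|: (B :\: E1))%SET.
  by apply/finset.setP => x; rewrite !inE; case: (x \in E1).
apply: (@leq_trans (a * (#|E1| + #|B :\: E1|))).
  by rewrite leq_mul2l leq_card_setU orbT.
by rewrite mulnDr leq_add2l.
Qed.

Section Pluck.
Variables n x : nat.
Local Notation coloring := {ffun 'I_n -> 'I_x}.
Implicit Types (chi : coloring) (W X Z : {set 'I_n}).

Definition rainbow X chi := [forall i in X, forall j in X, (chi i == chi j) ==> (i == j)].

Lemma rainbowP X chi :
  reflect {in X &, injective chi} (rainbow X chi).
Proof.
apply: (iffP forall_inP) => [H i j iX jX eq|H i iX].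
  by have /forall_inP/(_ j jX) := H i iX; rewrite eq eqxx => /eqP.
by apply/forall_inP => j jX; apply/implyP => /eqP /H ->.
Qed.

Lemma rainbowS X X' chi : X \subset X' -> rainbow X' chi -> rainbow X chi.
Proof.
move=> /fintype.subsetP XX' /rainbowP H; apply/rainbowP => i j iX jX.
by apply: H; apply: XX'.
Qed.

Definition recolor chi i c : coloring := [ffun j => if j == i then c else chi j].

Lemma rainbow_recolor X chi i c : i \notin X ->
  rainbow X (recolor chi i c) = rainbow X chi.
Proof.
move=> iX; apply: eq_forallb_in => a aX; apply: eq_forallb_in => b bX.
by rewrite !ffunE !ifN //; [apply: contraNneq iX => <- | apply: contraNneq iX => <-].
Qed.

(** Changing the colour at i maps the pairs of a colouring in the set and a colour
    injectively into A: a colouring with chi i = chi j can be recovered because j is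
    not touched. *)
Lemma card_agree (A : {set coloring}) i j :
  i != j -> (forall chi c, chi \in A -> recolor chi i c \in A) ->
  (x * #|[set chi in A | chi i == chi j]| <= #|A|)%N.
Proof.
move=> ij clA; rewrite -[x in (x * _)%N]card_ord -cardsT mulnC -cardsX.
pose F (p : coloring * 'I_x) := recolor p.1 i p.2.
rewrite -(@card_in_imset _ _ F); last first.
  move=> [chi1 c1] [chi2 c2] /=; rewrite !inE /= !andbT.
  move=> /andP[_ /eqP e1] /andP[_ /eqP e2] /ffunP eF.
  have ce : c1 = c2 by have := eF i; rewrite !ffunE eqxx.
  have ek k : k != i -> chi1 k = chi2 k.
    by move=> ki; have := eF k; rewrite !ffunE (negbTE ki).
  congr (_, _) => //; apply/ffunP => k; have [->|/ek //] := eqVneq k i.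
  by rewrite e1 e2 ek // eq_sym.
apply: subset_leq_card; apply/fintype.subsetP => chi' /imsetP[[chi c] chic ->].
by move: chic; rewrite !inE /= andbT => /andP[chiA _]; apply: clA.
Qed.

Lemma leq_card_bigcup (I T : finType) (P : pred I) (F : I -> {set T}) :
  (#|\bigcup_(i | P i) F i| <= \sum_(i | P i) #|F i|)%N.
Proof.
elim/big_rec2: _ => [|i k S _ IH]; first by rewrite cards0.
by apply: leq_trans (leq_card_setU _ _) _; rewrite leq_add2l.
Qed.

(** A union bound over the pairs with an element in Z: there are at most h (b + h) of them,
    and each is monochromatic for at most a fraction 1/x of the colourings in A, because
    A is closed under changing colours on Z. *)
Lemma pluck_one (A : {set coloring}) W Z h b :
  (0 < x)%N -> (2 * (h * (b + h)) <= x)%N -> (#|Z| <= h)%N -> (#|W| <= b)%N ->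
  [disjoint W & Z] ->
  (forall chi, chi \in A -> rainbow W chi) ->
  (forall chi i c, i \in Z -> chi \in A -> recolor chi i c \in A) ->
  (2 * #|[set chi in A | ~~ rainbow (W :|: Z) chi]| <= #|A|)%N.
Proof.
move=> x0 hx Zh Wb dWZ rA clA.
pose S (p : 'I_n * 'I_n) := [set chi in A | chi p.1 == chi p.2].
pose P := [pred p : 'I_n * 'I_n | (p \in finset.setX Z (W :|: Z)) && (p.1 != p.2)].
set bad := [set chi in A | _].
have sub : bad \subset \bigcup_(p | P p) S p.
  apply/fintype.subsetP => chi; rewrite inE => /andP[chiA].
  rewrite negb_forall_in => /exists_inP[i iWZ].
  rewrite negb_forall_in => /exists_inP[j jWZ].
  rewrite negb_imply => /andP[/eqP eij nij].
  have [iZ|iZ] := boolP (i \in Z).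
    apply/bigcupP; exists (i, j); rewrite !inE /= ?iZ ?nij ?chiA ?eij ?eqxx ?andbT //.
    by rewrite inE in jWZ.
  have [jZ|jZ] := boolP (j \in Z).
    apply/bigcupP; exists (j, i); rewrite !inE /= ?jZ ?chiA ?eij ?eqxx ?andbT //.
    by rewrite inE in iWZ; rewrite iWZ eq_sym nij.
  move: iWZ jWZ; rewrite !inE (negbTE iZ) (negbTE jZ) !orbF => iW jW.
  by case/eqP: nij; move/rainbowP: (rA _ chiA); apply.
have cS p : P p -> (x * #|S p| <= #|A|)%N.
  case: p => i j; rewrite !inE /= => /andP[/andP[iZ _] nij].
  by apply: card_agree => // chi c; apply: clA.
have xbad : (x * #|bad| <= h * (b + h) * #|A|)%N.
  apply: (@leq_trans (\sum_(p | P p) x * #|S p|)).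
    rewrite -big_distrr /= leq_mul2l; apply/orP; right.
    by apply: leq_trans (leq_card_bigcup _ _); apply: subset_leq_card.
  apply: (@leq_trans (\sum_(p | P p) #|A|)); first exact: leq_sum.
  rewrite sum_nat_const leq_mul2r; apply/orP; right.
  apply: (@leq_trans #|finset.setX Z (W :|: Z)|).
    by apply: subset_leq_card; apply/fintype.subsetP => p /andP[].
  rewrite cardsX leq_mul //.
  by apply: leq_trans (leq_card_setU _ _) _; apply: leq_add.
by rewrite -(leq_pmul2l x0) mulnCA; nia.
Qed.

(** The sets Z are disjoint, so the colourings selected by all the sets but one are still
    closed under recolouring on the last one, and each set halves their number. *)
Lemma pluck (Zs : seq {set 'I_n}) W h b :
  (0 < x)%N -> (2 * (h * (b + h)) <= x)%N -> (#|W| <= b)%N ->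
  all (fun Z : {set 'I_n} => (#|Z| <= h)%N && [disjoint W & Z]) Zs ->
  pairwise (fun Z Z' : {set 'I_n} => [disjoint Z & Z']) Zs ->
  (2 ^ size Zs * #|[set chi | rainbow W chi &
      all (fun Z : {set 'I_n} => ~~ rainbow (W :|: Z)%SET chi) Zs]| <= x ^ n)%N.
Proof.
move=> x0 hx Wb; elim: Zs => [|Z Zs IH] /=.
  move=> _ _; rewrite mul1n; apply: leq_trans (max_card _) _.
  by rewrite card_ffun !card_ord.
move=> /andP[/andP[Zh dWZ] okZs] /andP[dZ pZs].
apply: leq_trans (IH okZs pZs); rewrite expnSr -mulnA leq_mul2l.
apply/orP; right.
set A := (X in (_ <= #|pred_of_set X|)%N).
rewrite (_ : finset _ = [set chi in A | ~~ rainbow (W :|: Z)%SET chi]); last first.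
  by apply/finset.setP => chi; rewrite !inE -andbA [X in _ && X]andbC.
apply: (pluck_one x0 hx Zh Wb dWZ).
  by move=> chi; rewrite inE => /andP[].
move=> chi i c iZ; rewrite !inE => /andP[rW /allP H].
have iW : i \notin W by move: dWZ; rewrite disjoint_sym => /disjointFr->.
rewrite rainbow_recolor // rW; apply/allP => Z' Z'Zs.
rewrite rainbow_recolor ?H // inE negb_or iW.
by move/allP: dZ => /(_ _ Z'Zs) /disjointFr->.
Qed.
End Pluck.

(** * Clauses falsified by a placement and a colouring *)

Section Falsify.
Variables n omega xi : nat.
Local Notation var := (var n omega xi).
Local Notation cls := (clause var).
Local Notation coloring := {ffun 'I_n -> 'I_xi}.
Local Notation placement := {ffun 'I_omega -> 'I_n}.
Implicit Types (C D E : cls) (chi : coloring) (f : placement).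

Definition mono chi (e : upair n) : bool :=
  [forall i in val e, forall j in val e, chi i == chi j].

(** The edge variable is true exactly on the edges that are not monochromatic, which
    makes all clauses of Color true for every chi. *)
Definition truth (q : 'I_omega -> 'I_n -> bool) chi (x : var) : bool :=
  match x with
  | inl (inl e) => ~~ mono chi e
  | inl (inr (u, i)) => q u i
  | inr (i, v) => chi i == v
  end.

Definition row (x : var) : option 'I_omega :=
  if x is inl (inr (u, _)) then Some u else None.

Definition row_false (q : 'I_omega -> 'I_n -> bool) C u : bool :=
  [forall l in C, (row l.2 == Some u) ==>
     (if l.2 is inl (inr (v, j)) then q v j != l.1 else true)].

(** The vertices at which row u may be put so as to falsify all literals of that row. *)
Definition places C u : {set 'I_n} :=
  [set i | row_false (fun _ j => j == i) C u].

Definition color_false C chi : bool :=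
  [forall l in C, (row l.2 == None) ==> (truth (fun _ _ => false) chi l.2 != l.1)].

Lemma falsifiedE q chi C :
  ~~ sat_clause [ffun x => truth q chi x] C =
  [forall u, row_false q C u] && color_false C chi.
Proof.
rewrite negb_exists_in; apply/forall_inP/andP => [H|[/forallP Hr /forall_inP Hc] l lC].
  split; last first.
    apply/forall_inP => l lC; have := H l lC; rewrite ffunE.
    by case: l lC => [b [[e|[u i]]|[i v]]] //= _ ->.
  apply/forallP => u; apply/forall_inP => l lC; have := H l lC; rewrite ffunE.
  by case: l lC => [b [[e|[v i]]|[i v]]] //= _ ->; rewrite implybT.
have := Hc l lC; rewrite ffunE.
case: l lC => [b [[e|[u i]]|[i v]]] //= lC _.
have /forall_inP/(_ _ lC) /= := Hr u.
by rewrite eqxx.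
Qed.

Lemma row_falseS q C D u :
  (forall l, l \in C -> row l.2 = Some u -> l \in D) ->
  row_false q D u -> row_false q C u.
Proof.
move=> CD /forall_inP H; apply/forall_inP => l lC; apply/implyP => /eqP rl.
by have := H l (CD l lC rl); rewrite rl eqxx.
Qed.

Lemma placesS C D u :
  (forall l, l \in C -> row l.2 = Some u -> l \in D) ->
  places D u \subset places C u.
Proof.
move=> CD; apply/fintype.subsetP => i; rewrite !inE; exact: row_falseS.
Qed.

Lemma resolvent_color C D E x :
  row x = None -> C \subset pos x |: E -> D \subset neg x |: E ->
  [/\ forall u, places E u \subset places C u,
      forall u, places E u \subset places D u &
      forall chi, color_false E chi -> color_false C chi \/ color_false D chi].
Proof.
move=> rx /fintype.subsetP CE /fintype.subsetP DE; split=> [u|u|chi /forall_inP H].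
- apply: placesS => l /CE; rewrite !inE => /orP[/eqP->|//].
  by rewrite /= rx.
- apply: placesS => l /DE; rewrite !inE => /orP[/eqP->|//].
  by rewrite /= rx.
case xv : (truth (fun _ _ => false) chi x); [right|left].
  apply/forall_inP => l /DE; rewrite !inE => /orP[/eqP->|/H //].
  by rewrite /= xv implybT.
apply/forall_inP => l /CE; rewrite !inE => /orP[/eqP->|/H //].
by rewrite /= xv implybT.
Qed.

Lemma resolvent_row C D E u i :
  C \subset pos (qvar xi u i) |: E -> D \subset neg (qvar xi u i) |: E ->
  [/\ forall v, v != u -> places E v \subset places C v,
      forall v, v != u -> places E v \subset places D v,
      forall chi, color_false E chi -> color_false C chi,
      forall chi, color_false E chi -> color_false D chi &
      forall j, j \in places E u -> j \in places C u \/ j \in places D u].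
Proof.
move=> /fintype.subsetP CE /fintype.subsetP DE; split.
- move=> v vu; apply: placesS => l /CE; rewrite !inE => /orP[/eqP->|//] /= [uv].
  by rewrite uv eqxx in vu.
- move=> v vu; apply: placesS => l /DE; rewrite !inE => /orP[/eqP->|//] /= [uv].
  by rewrite uv eqxx in vu.
- move=> chi /forall_inP H; apply/forall_inP => l /CE.
  by rewrite !inE => /orP[/eqP-> //|/H //].
- move=> chi /forall_inP H; apply/forall_inP => l /DE.
  by rewrite !inE => /orP[/eqP-> //|/H //].
move=> j; rewrite !inE => /forall_inP H.
have [ij|ij] := eqVneq i j; [right|left]; apply/forall_inP => l.
  by move=> /DE; rewrite !inE => /orP[/eqP->|/H //] /=; rewrite ij !eqxx.
by move=> /CE; rewrite !inE => /orP[/eqP->|/H //] /=; rewrite (negbTE ij) /= implybT.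
Qed.

Lemma color_not_false C chi : C \in color n omega xi -> ~~ color_false C chi.
Proof.
rewrite inE => /or3P[].
- move=> /existsP[i /eqP->]; apply/negP => /forall_inP H.
  have /H /= : pos (rvar omega i (chi i)) \in
    [set pos (rvar omega i v) | v : 'I_xi]%SET by apply: imset_f.
  by rewrite eqxx.
- move=> /existsP[u /existsP[v /existsP[i /andP[uv /eqP->]]]].
  apply/negP => /forall_inP H.
  have := H (neg (rvar omega i u)); have := H (neg (rvar omega i v)).
  rewrite !inE !eqxx orbT /= !eqbF_neg !negbK => /(_ isT) /eqP cv /(_ isT) /eqP cu.
  by rewrite -cu cv eqxx in uv.
move=> /existsP[v /existsP[i /existsP[j /existsP[e /and3P[ij /eqP eE /eqP->]]]]].
apply/negP => /forall_inP H.
have := H (neg (rvar omega i v)); have := H (neg (rvar omega j v)).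
have := H (neg (pvar omega xi e)).
rewrite !inE !eqxx !orbT /= !eqbF_neg !negbK => /(_ isT) mij.
move=> /(_ isT) /eqP cj /(_ isT) /eqP ci; case/negP: mij.
apply/forall_inP => a; rewrite eE !inE => /orP ae.
apply/forall_inP => b; rewrite !inE => /orP be.
by case: ae => /eqP->; case: be => /eqP->; rewrite ?ci ?cj.
Qed.

(** A falsified clause of Clique determines the positions of two rows and forces the two
    vertices to have the same colour (they may coincide). *)
Lemma clique_false C f : C \in clique n omega xi ->
  (forall u, f u \in places C u) ->
  exists u v, [/\ u != v, places C u \subset [set f u],
     places C v \subset [set f v] &
     forall chi, color_false C chi -> chi (f u) = chi (f v)].
Proof.
have single u i : neg (qvar xi u i) \in C -> places C u \subset [set i].
  move=> lC; apply/fintype.subsetP => j; rewrite !inE => /forall_inP/(_ _ lC) /=.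
  by rewrite eqxx eqbF_neg negbK eq_sym.
rewrite inE => /or3P[].
- move=> /existsP[u /eqP CE] /(_ u); rewrite inE => /forall_inP H.
  have lC : pos (qvar xi u (f u)) \in C by rewrite CE; apply: imset_f.
  by have := H _ lC; rewrite /= !eqxx.
- move=> /existsP[u /existsP[v /existsP[i /andP[uv /eqP CE]]]] fC.
  have pu := single u i; have pv := single v i.
  rewrite CE !inE eqxx -CE in pu; rewrite CE !inE eqxx orbT -CE in pv.
  move: (fintype.subsetP (pu isT) _ (fC u)) (fintype.subsetP (pv isT) _ (fC v)).
  rewrite !inE => /eqP fu /eqP fv; exists u, v; rewrite fu fv.
  by split; [|apply: pu|apply: pv|].
move=> /existsP[u /existsP[v /existsP[i /existsP[j /existsP[e]]]]].
move=> /and4P[uv ij /eqP eE /eqP CE] fC.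
have pu := single u i; have pv := single v j.
rewrite CE !inE eqxx -CE in pu; rewrite CE !inE eqxx orbT -CE in pv.
move: (fintype.subsetP (pu isT) _ (fC u)) (fintype.subsetP (pv isT) _ (fC v)).
rewrite !inE => /eqP fu /eqP fv; exists u, v; rewrite fu fv.
split; [by []|exact: pu|exact: pv|move=> chi cC].
have /forall_inP/(_ (pos (pvar omega xi e))) := cC.
rewrite CE !inE eqxx orbT /= => /(_ isT).
rewrite -[_ != true]/(~~ (_ == true)) eqb_id negbK => /forall_inP /(_ i).
rewrite eE !inE eqxx => /(_ isT) /forall_inP /(_ j).
by rewrite !inE eqxx orbT => /(_ isT) /eqP.
Qed.

End Falsify.

(** * Placements caught along a refutation *)

Section Framework.
Variables n omega xi : nat.
Local Notation var := (var n omega xi).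
Local Notation cls := (clause var).
Local Notation coloring := {ffun 'I_n -> 'I_xi}.
Local Notation placement := {ffun 'I_omega -> 'I_n}.
Implicit Types (C E : cls) (chi : coloring) (f : placement) (X Y : {set 'I_n}).

Variables (Delta : {set cls}) (pi : seq cls).
Hypothesis pi_refutes :
  resolution_refutation (clique n omega xi :|: color n omega xi :|: Delta)%SET pi.

Variables (D : 'I_omega -> nat) (T T0 : nat) (G : {set placement}).
(** [Dead C X] is an abstract notion of a set X of occupied vertices that suffices to
    refute C, and [ok C X] a condition on X under which it behaves well.  The hypotheses
    below list what the notion must satisfy; it is instantiated in two different
    ways, according to the number of colours. *)
Variables (Dead ok : cls -> {set 'I_n} -> Prop).

Definition pinned C : {set 'I_omega} := [set u | (#|places C u| < D u + T)%N].

Lemma pinnedS C E u : places E u \subset places C u ->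
  u \in pinned C -> u \in pinned E.
Proof. by move=> /subset_leq_card le; rewrite !inE; apply: leq_ltn_trans. Qed.

Hypothesis DT_gt1 : forall u, (1 < D u + T)%N.
Hypothesis DT_len : forall u, (D u + T <= n)%N.
Hypothesis G_nonempty : exists f, f \in G.
Hypothesis G_line : forall f u (B : {set 'I_n}), f \in G -> (D u <= #|B|)%N ->
  exists2 i, i \in B & upd f u i \in G.
Hypothesis okP : forall C f, C \in pi -> f \in G ->
  (forall u, f u \in places C u) -> ok C (f @: pinned C)%SET.
Hypothesis ok_small : forall C X, ok C X -> (#|X| + T0 <= T)%N.
Hypothesis Delta_leaf : forall C, C \in pi -> C \in Delta ->
  (forall X, Dead C X) \/ (forall f, f \in G -> exists u, f u \notin places C u).
Hypothesis Dead_never : forall C, (forall chi, ~~ color_false C chi) ->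
  forall X, Dead C X.
Hypothesis Dead_pair : forall C i j, i != j ->
  (forall chi, color_false C chi -> chi i = chi j) -> Dead C [set i; j]%SET.
Hypothesis DeadS : forall C X Y, X \subset Y -> Dead C X -> Dead C Y.
Hypothesis DeadW : forall C E X,
  (forall chi, color_false E chi -> color_false C chi) -> Dead C X -> Dead E X.
Hypothesis DeadV : forall C0 C1 E X, E \in pi -> ok E X ->
  (forall chi, color_false E chi -> color_false C0 chi \/ color_false C1 chi) ->
  Dead C0 X -> Dead C1 X -> Dead E X.
Hypothesis Dead_few : forall E X, E \in pi -> ok E X -> ~ Dead E X ->
  exists Y : {set 'I_n}, (#|Y| <= T0)%N /\ forall i, Dead E (i |: X)%SET -> i \in Y.

Definition caught f C :=
  (exists u v, [/\ u \in pinned C, v \in pinned C, u != v & f u = f v]) \/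
  Dead C (f @: pinned C)%SET.

(** The passage from a premise C to the conclusion E, when all rows pinned in C are put
    injectively into X: a collision is excluded, so the premise is dead. *)
Lemma caught_step C E f (X : {set 'I_n}) (P : {set 'I_omega}) :
  pinned C \subset P -> {in P &, injective f} -> (f @: P)%SET \subset X ->
  (forall chi, color_false E chi -> color_false C chi) ->
  caught f C -> Dead E X.
Proof.
move=> /fintype.subsetP CP injf fPX EC [[u [v [uC vC /eqP uv fuv]]]|dC].
  by case: uv; apply: injf => //; apply: CP.
apply: DeadW EC _; apply: DeadS dC.
by apply: fintype.subset_trans fPX; apply/imsetS/fintype.subsetP.
Qed.

Lemma injective_or_collision f (P : {set 'I_omega}) :
  {in P &, injective f} \/ exists u v, [/\ u \in P, v \in P, u != v & f u = f v].
Proof.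
have [/existsP[u /existsP[v /and4P[uP vP uv /eqP fuv]]]|H] :=
  boolP [exists u, exists v, [&& u \in P, v \in P, u != v & f u == f v]].
  by right; exists u, v.
left=> u v uP vP /eqP fuv; apply/eqP; apply: contraNT H => uv.
by apply/existsP; exists u; apply/existsP; exists v; rewrite uP vP uv.
Qed.

Lemma resolvent_subsets (C E F : cls) (x : var) C' F' :
  C = (pos x |: C')%SET -> F = (neg x |: F')%SET -> E = (C' :|: F')%SET ->
  C \subset pos x |: E /\ F \subset neg x |: E.
Proof.
move=> -> -> ->; split; apply: finset.setUS; [exact: finset.subsetUl|exact: finset.subsetUr].
Qed.

(** The invariant of the refutation.  For a resolution on p or r, the conclusion pins
    all the rows pinned in the premises.  For a resolution on q_ui, each f falsifies the
    literals of the row u in one of the premises.  Only the row u can be pinned in that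
    premise and not in the conclusion.  If so, there is enough space to move f u
    off the occupied vertices and off the at most T0 vertices that would make the occupied
    set dead, and the moved placement yields a contradiction unless the occupied set was
    dead from the start. *)
Lemma caught_everywhere i f : (i < size pi)%N -> f \in G ->
  (forall u, f u \in places (nth (empty_clause _) pi i) u) ->
  caught f (nth (empty_clause _) pi i).
Proof.
elim/ltn_ind: i f => i IH f ipi fG fE.
set E := nth _ pi i in fE *.
have Epi : E \in pi by apply: mem_nth.
case: (pi_refutes) => _ /(_ i ipi) [|[j [k [ji ki]]]]; rewrite -/E.
  rewrite 2!finset.in_setU -orbA => /or3P[Ecl|Eco|ED].
  - have [u [v [uv pu pv H]]] := clique_false Ecl fE.
    have pin w : places E w \subset [set f w] -> w \in pinned E.
      move=> /subset_leq_card; rewrite cards1 inE => le.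
      by apply: leq_ltn_trans le _.
    have [fuv|fuv] := eqVneq (f u) (f v).
      by left; exists u, v; split=> //; apply: pin.
    right; apply: DeadS (Dead_pair fuv H); rewrite finset.subUset !finset.sub1set.
    by rewrite !imset_f // pin.
  - by right; apply: Dead_never => chi; apply: color_not_false.
  - have [H|H] := Delta_leaf Epi ED; first by right; apply: H.
    by have [u] := H f fG; rewrite fE.
have jpi := ltn_trans ji ipi; have kpi := ltn_trans ki ipi.
move=> [x [C' [F' [CE FE EE]]]].
have [CxE FxE] := resolvent_subsets CE FE EE.
set C := nth _ pi j in CE CxE; set F := nth _ pi k in FE FxE.
have IHC f' := IH j ji f' jpi; have IHF f' := IH k ki f' kpi.
rewrite -/C in IHC; rewrite -/F in IHF.
have [injf|[u [v ?]]] := injective_or_collision f (pinned E); last first.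
  by left; exists u, v.
have okE := okP Epi fG fE.
have [rx|[u [a xE]]] : row x = None \/ exists u a, x = qvar xi u a.
  by case: (x) => [[e|[u a]]|[a v]] /=; [left|right; exists u, a|left].
  have [pC pF cE] := resolvent_color rx CxE FxE.
  have sub A : (forall u, places E u \subset places A u) -> pinned A \subset pinned E.
    by move=> H; apply/fintype.subsetP => u; apply: pinnedS.
  right; apply: (DeadV Epi okE cE).
    apply: (caught_step (sub _ pC) injf (fintype.subxx _) (fun _ h => h) (IHC f fG _)) => // u.
    by apply: (fintype.subsetP (pC u)).
  apply: (caught_step (sub _ pF) injf (fintype.subxx _) (fun _ h => h) (IHF f fG _)) => // u.
  by apply: (fintype.subsetP (pF u)).
rewrite xE in CxE FxE.
have [pC pF cC cF split_u] := resolvent_row CxE FxE.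
have stepE f' : f' \in G -> (forall v, f' v \in places E v) ->
    exists A, [/\ caught f' A, forall chi, color_false E chi -> color_false A chi &
      pinned A \subset u |: pinned E].
  have sub A : (forall v, v != u -> places E v \subset places A v) ->
      pinned A \subset u |: pinned E.
    move=> H; apply/fintype.subsetP => v vA; rewrite finset.in_setU1.
    by have [//|vu] := eqVneq v u; apply: pinnedS vA; apply: H.
  move=> f'G f'E; have [f'C|f'F] := split_u _ (f'E u).
    exists C; split; [apply: IHC => // v|exact: cC|exact: sub].
    by have [->//|vu] := eqVneq v u; apply: (fintype.subsetP (pC v vu)).
  exists F; split; [apply: IHF => // v|exact: cF|exact: sub].
  by have [->//|vu] := eqVneq v u; apply: (fintype.subsetP (pF v vu)).
have [uE|uE] := boolP (u \in pinned E).
  have [A [cA EA]] := stepE f fG fE.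
  rewrite (finset.setUidPr _) ?finset.sub1set // => AE.
  by right; apply: (caught_step AE injf (fintype.subxx _) EA cA).
right; apply: contrapT => ndead.
have [Y [YT Yin]] := Dead_few Epi okE ndead.
set X := (f @: pinned E)%SET in okE ndead YT Yin *.
(* The vertices at which the row u still falsifies E, except the occupied ones and
   those that would make the occupied set dead. *)
pose B := places E u :\: (X :|: Y).
have DB : (D u <= #|B|)%N.
  move: uE; rewrite inE -leqNgt => big.
  rewrite cardsD; have := subset_leq_card (finset.subsetIr (places E u) (X :|: Y)).
  have := leq_of_leqif (leq_card_setU X Y); have := ok_small okE.
  move: big YT; move: #|X| #|Y| #|_ :|: _|%SET #|_ :&: _|%SET #|_|.
  by move=> a1 a2 a3 a4 a5; lia.
have [c] := G_line fG DB; rewrite !inE negb_or => /andP[/andP[cX cY] cE] f'G.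
set f' := upd f u c in f'G.
have f'E v : f' v \in places E v.
  by have [->|vu] := eqVneq v u; rewrite ?upd_eq ?upd_neq // inE.
have [A [cA EA AE]] := stepE f' f'G f'E.
have f'u : f' u = c by rewrite upd_eq.
case/negP: cY; apply: Yin; apply: (caught_step AE _ _ EA cA).
  have f'X v : v \in pinned E -> f' v \in X.
    move=> vE; rewrite upd_neq ?imset_f //.
    by apply: contraNneq uE => <-.
  have f'f v : v \in pinned E -> f' v = f v.
    by move=> vE; rewrite upd_neq //; apply: contraNneq uE => <-.
  move=> v w; rewrite !finset.in_setU1 => /orP[/eqP->|vE] /orP[/eqP->|wE] //.
  - by rewrite f'u => cw; have := f'X w wE; rewrite -cw (negbTE cX).
  - by rewrite f'u => cw; have := f'X v vE; rewrite cw (negbTE cX).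
  - by rewrite !f'f //; apply: injf.
rewrite imsetU1 upd_eq; apply: finset.setUS; apply/fintype.subsetP => a' /imsetP[v vE ->].
rewrite upd_neq ?imset_f //; by apply: contraNneq uE => <-.
Qed.

(** Every placement is in the box of the empty clause, and no row is pinned there. *)
Lemma Dead_root : Dead (empty_clause _) finset.set0.
Proof.
have [f fG] := G_nonempty; case: (pi_refutes) => [[pi' piE] _].
have full u : places (empty_clause var) u = [set: 'I_n]%SET.
  by apply/finset.setP => i; rewrite !inE; apply/forall_inP => l; rewrite inE.
have pin0 : pinned (empty_clause var) = finset.set0.
  apply/finset.setP => u; rewrite !inE full cardsT card_ord; apply/negbTE.
  by rewrite -leqNgt.
have lt : (size pi' < size pi)%N by rewrite piE size_rcons.
have E0 : nth (empty_clause var) pi (size pi') = empty_clause var.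
  by rewrite piE nth_rcons ltnn eqxx.
have := caught_everywhere lt fG; rewrite E0 => /(_ _)[u||].
- by rewrite full inE.
- by move=> [u [v []]]; rewrite pin0 inE.
- by rewrite pin0 imset0.
Qed.

End Framework.

(** * Nogood sets of vertices *)

(** Such a set is the range of a map from B points to the elements and a blank. *)
Lemma card_small_sets (T : finType) (B : nat) :
  (#|[set X : {set T} | (#|X| <= B)%N]| <= #|T|.+1 ^ B)%N.
Proof.
rewrite -card_option -{2}[B]card_ord -card_ffun -cardsT.
pose F (g : {ffun 'I_B -> option T}) : {set T} := [set x | Some x \in codom g].
apply: leq_trans (leq_imset_card F _); apply: subset_leq_card.
apply/fintype.subsetP => X; rewrite inE => XB; apply/imsetP.
exists [ffun i : 'I_B => nth None (map some (enum X)) i]; rewrite ?inE //.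
apply/finset.setP => x; rewrite inE; apply/idP/codomP => [xX|[i]].
  have xi : (index x (enum X) < #|X|)%N by rewrite cardE index_mem mem_enum.
  exists (Ordinal (leq_trans xi XB)); rewrite ffunE /=.
  by rewrite (nth_map x) ?nth_index ?mem_enum // -cardE.
rewrite ffunE; have [lt|ge] := ltnP i (size (enum X)).
  by rewrite (nth_map x) // => -[->]; rewrite -mem_enum mem_nth.
by rewrite nth_default // size_map.
Qed.

Section Nogood.
Variables n omega xi : nat.
Local Notation var := (var n omega xi).
Local Notation cls := (clause var).
Local Notation coloring := {ffun 'I_n -> 'I_xi}.
Implicit Types (C E : cls) (chi : coloring) (X Y W Z : {set 'I_n}).

Definition clash C X : {set coloring} := [set chi | color_false C chi & rainbow X chi].

(** Up to the exceptional colourings in bad, no colouring falsifies C and separates the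
    vertices of X. *)
Definition nogood (bad : {set coloring}) C X := clash C X \subset bad.

Lemma nogoodS bad C X Y : X \subset Y -> nogood bad C X -> nogood bad C Y.
Proof.
move=> XY; apply: fintype.subset_trans; apply/fintype.subsetP => chi.
by rewrite !inE => /andP[-> /(rainbowS XY)].
Qed.

Lemma nogoodW bad C E X : (forall chi, color_false E chi -> color_false C chi) ->
  nogood bad C X -> nogood bad E X.
Proof.
move=> EC; apply: fintype.subset_trans; apply/fintype.subsetP => chi.
by rewrite !inE => /andP[/EC-> ->].
Qed.

Lemma nogoodV bad C0 C1 E X :
  (forall chi, color_false E chi -> color_false C0 chi \/ color_false C1 chi) ->
  nogood bad C0 X -> nogood bad C1 X -> nogood bad E X.
Proof.
move=> EC /fintype.subsetP n0 /fintype.subsetP n1; apply/fintype.subsetP => chi.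
rewrite inE => /andP[/EC[c|c] r]; [apply: n0|apply: n1]; by rewrite inE c.
Qed.

Lemma nogood_never bad C X : (forall chi, ~~ color_false C chi) -> nogood bad C X.
Proof.
by move=> H; apply/fintype.subsetP => chi; rewrite inE (negbTE (H chi)).
Qed.

Lemma nogood_pair bad C i j : i != j ->
  (forall chi, color_false C chi -> chi i = chi j) -> nogood bad C [set i; j].
Proof.
move=> ij H; apply/fintype.subsetP => chi; rewrite inE => /andP[/H eq /rainbowP r].
by case/eqP: ij; apply: r; rewrite // !inE eqxx ?orbT.
Qed.

Section Saturated.
Variables (pi : seq cls) (bad : {set coloring}) (B r : nat).
Hypothesis saturated : forall C X, C \in pi -> (#|X| <= B)%N ->
  clash C X \subset bad \/ (xi ^ n < 2 ^ r * #|clash C X :\: bad|)%N.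
Hypothesis xi_gt0 : (0 < xi)%N.

(** The colourings that falsify C and are injective on W but lie outside bad cannot be
    injective on any W :|: Z.  By plucking there are at most a fraction 2^-r of them, so by
    saturation there are none. *)
Lemma nogood_pluck C W (Zs : seq {set 'I_n}) h b :
  C \in pi -> (b <= B)%N -> (2 * (h * (b + h)) <= xi)%N -> (#|W| <= b)%N ->
  (r <= size Zs)%N ->
  all (fun Z : {set 'I_n} => (#|Z| <= h)%N && [disjoint W & Z]) Zs ->
  pairwise (fun Z Z' : {set 'I_n} => [disjoint Z & Z']) Zs ->
  (forall Z, Z \in Zs -> nogood bad C (W :|: Z)) ->
  nogood bad C W.
Proof.
move=> Cpi bB hb Wb rZ aZ pZ nZ.
case: (saturated Cpi (leq_trans Wb bB)) => // lt; exfalso; move: lt.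
apply/negP; rewrite -leqNgt; apply: leq_trans (pluck xi_gt0 hb Wb aZ pZ).
apply: leq_mul; first by rewrite leq_exp2l.
apply: subset_leq_card; apply/fintype.subsetP => chi.
rewrite finset.inE [in X in _ && X]inE => /andP[nbad /andP[cC rW]].
rewrite inE rW /=; apply/allP => Z /nZ /fintype.subsetP H.
by apply: contra nbad => rWZ; apply: H; rewrite inE cC.
Qed.

(** Plucking with single vertices as petals. *)
Lemma few_nogood_extensions C W b : C \in pi -> (b <= B)%N ->
  (2 * b.+1 <= xi)%N -> (#|W| <= b)%N -> ~~ nogood bad C W ->
  (#|[set i | nogood bad C (i |: W)]| <= r)%N.
Proof.
move=> Cpi bB hb Wb nW; set Y := finset _; rewrite leqNgt; apply/negP => rY.
have YW i : i \in Y -> i \notin W.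
  by rewrite inE; apply: contraL => iW; rewrite (finset.setUidPr _) ?finset.sub1set.
case/negP: nW; apply: (@nogood_pluck C W [seq [set i]%SET | i <- enum Y] 1 b) => //.
- by rewrite mul1n addn1.
- by rewrite size_map -cardE ltnW.
- apply/allP => Z /mapP[i]; rewrite mem_enum => /YW iW ->.
  by rewrite cards1 disjoint_sym disjoints1.
- rewrite pairwise_map; have := enum_uniq Y; rewrite uniq_pairwise.
  apply: sub_pairwise => i j /= ij; rewrite disjoints1 inE.
  exact: ij.
- by move=> Z /mapP[i]; rewrite mem_enum inE finset.setUC => ? ->.
Qed.

(** K is the union of a maximal disjoint family of sets Z that make P :|: Z nogood.  The
    family has fewer than r members, for otherwise plucking would make P nogood. *)
Lemma kernel_of_nogood C (P : {set 'I_n}) l h : C \in pi -> (l <= B)%N ->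
  (2 * (h * (l + h)) <= xi)%N -> (#|P| <= l)%N -> ~~ nogood bad C P ->
  exists K : {set 'I_n}, [/\ (#|K| <= r * h)%N, [disjoint K & P] &
    forall X, (#|X| <= h)%N -> nogood bad C (P :|: X) -> X :&: K != finset.set0].
Proof.
move=> Cpi lB hl Pl nP; apply: contrapT => noK.
suff H j : exists Zs : seq {set 'I_n}, [/\ size Zs = j,
   all (fun Z : {set 'I_n} => (#|Z| <= h)%N && [disjoint P & Z]) Zs,
   pairwise (fun Z Z' : {set 'I_n} => [disjoint Z & Z']) Zs &
   forall Z, Z \in Zs -> nogood bad C (P :|: Z)].
  have [Zs [sZ aZ pZ nZ]] := H r; case/negP: nP.
  by apply: (nogood_pluck Cpi lB hl Pl _ aZ pZ nZ); rewrite sZ.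
elim: j => [|j [Zs [sZ aZ pZ nZ]]]; first by exists [::].
have [rj|jr] := leqP r j.
  case/negP: nP; apply: (nogood_pluck Cpi lB hl Pl _ aZ pZ nZ); by rewrite sZ.
pose K := (\bigcup_(Z <- Zs) Z)%SET.
have ZK Z : Z \in Zs -> Z \subset K.
  by rewrite /K => ZZs; rewrite (big_rem _ ZZs) finset.subsetUl.
have [X [Xh nX XK]] : exists X, [/\ (#|X| <= h)%N, nogood bad C (P :|: X) &
    [disjoint X & K]].
  apply: contrapT => noX; case: noK; exists K; split.
  - rewrite /K; apply: (@leq_trans (j * h)); last by rewrite leq_mul2r ltnW ?orbT.
    rewrite -sZ; elim: (Zs) aZ => [|Z s IH] /=; first by rewrite big_nil cards0.
    move=> /andP[/andP[Zh _] /IH]; rewrite big_cons mulSn => le.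
    by apply: leq_trans (leq_of_leqif (leq_card_setU _ _)) _; apply: leq_add.
  - rewrite /K disjoint_sym; elim: (Zs) aZ => [|Z s IH] /=.
      by rewrite big_nil -setI_eq0 finset.setI0.
    move=> /andP[/andP[_ dZ] /IH ds]; rewrite big_cons.
    by rewrite -setI_eq0 finset.setIUr finset.setU_eq0 !setI_eq0 dZ.
  - move=> X Xh nX; rewrite setI_eq0; apply/negP => dX.
    by case: noX; exists X.
exists ((X :\: P)%SET :: Zs); split=> /=.
- by rewrite sZ.
- rewrite aZ andbT; apply/andP; split.
    by apply: leq_trans Xh; apply: subset_leq_card; apply: finset.subsetDl.
  rewrite -setI_eq0; apply/eqP/finset.setP => x.
  by rewrite !inE; case: (x \in P).
- rewrite pZ andbT; apply/allP => Z /ZK ZK'.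
  apply: disjointWl (finset.subsetDl _ _) _; exact: disjointWr ZK' XK.
move=> Z; rewrite inE => /orP[/eqP->|/nZ //].
rewrite (_ : P :|: X :\: P = P :|: X)%SET //; apply/finset.setP => x.
by rewrite !inE; case: (x \in P).
Qed.

End Saturated.

Lemma saturate (pi : seq cls) (E0 : {set coloring}) (B r : nat) :
  exists bad : {set coloring}, [/\ E0 \subset bad,
    (2 ^ r * #|bad| <= 2 ^ r * #|E0| + size pi * n.+1 ^ B * xi ^ n)%N &
    forall C X, C \in pi -> (#|X| <= B)%N ->
      clash C X \subset bad \/ (xi ^ n < 2 ^ r * #|clash C X :\: bad|)%N].
Proof.
pose Xs := enum [set X : {set 'I_n} | (#|X| <= B)%N].
have [bad [E0b sb satb]] := absorb_small_remainders
  [seq clash C X | C <- pi, X <- Xs] E0 (2 ^ r) (xi ^ n).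
exists bad; split=> //.
  apply: (leq_trans sb); rewrite leq_add2l size_allpairs leq_mul2r.
  rewrite leq_mul2l /Xs -cardE; have := card_small_sets 'I_n B.
  by rewrite card_ord => ->; rewrite !orbT.
move=> C X Cpi XB; apply: satb; apply/allpairsP; exists (C, X); split=> //=.
by rewrite mem_enum inE.
Qed.

End Nogood.

(** * Relative sizes of boxes, and chains *)

Section RelativeSize.
Variables (R : realFieldType) (m n : nat) (D : 'I_m -> nat).
Hypothesis D_gt0 : forall u, (0 < D u)%N.
Implicit Types (c : {ffun 'I_m -> {set 'I_n}}).

Definition rel_size c : R := \prod_u ((minn #|c u| (D u))%:R / (D u)%:R).

Lemma rel_size_ge0 c : 0 <= rel_size c.
Proof. by apply: prodr_ge0 => u _; rewrite divr_ge0. Qed.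

Lemma rel_size_le_prod c (a : 'I_m -> R) :
  (forall u, (minn #|c u| (D u))%:R / (D u)%:R <= a u) ->
  rel_size c <= \prod_u a u.
Proof. by move=> H; apply: ler_prod => u _; rewrite H andbT divr_ge0. Qed.

Lemma ratio_le1 c u : (minn #|c u| (D u))%:R / (D u)%:R <= 1 :> R.
Proof.
by rewrite ler_pdivrMr ?ltr0n // mul1r ler_nat geq_minr.
Qed.

Lemma rel_size_le_exp c (A : {set 'I_m}) (a : R) :
  (forall u, u \in A -> (minn #|c u| (D u))%:R / (D u)%:R <= a) ->
  rel_size c <= a ^+ #|A|.
Proof.
move=> H; apply: (@le_trans _ _ (\prod_u (if u \in A then a else 1))).
  by apply: rel_size_le_prod => u; case: ifP => [/H //|_]; apply: ratio_le1.
by rewrite -big_mkcond prodr_const.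
Qed.

(** This is [line_closed_avoidance] with the inequality divided by the product of the
    degrees. *)
Lemma avoidance (cs : seq {ffun 'I_m -> {set 'I_n}}) :
  (forall u, D u <= n)%N -> \sum_(c <- cs) rel_size c < 1 ->
  exists G : {set {ffun 'I_m -> 'I_n}},
  [/\ exists f, f \in G,
      forall c f, c \in cs -> f \in G -> exists u, f u \notin c u &
      forall f u (B : {set 'I_n}), f \in G -> (D u <= #|B|)%N ->
        exists2 i, i \in B & upd f u i \in G].
Proof.
move=> Dn small; have [|G [G0 Gav Gl]] := @line_closed_avoidance m n D Dn cs.
  have P0 : (0 : R) < \prod_u (D u)%:R by apply: prodr_gt0 => u _; rewrite ltr0n.
  rewrite -(ltr_nat R) natr_sum -[X in _ < X]mul1r natr_prod.
  rewrite -(ltr_pM2r P0) mulr_suml in small.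
  apply: le_lt_trans small; apply: ler_sum => c _.
  rewrite natr_prod /rel_size -big_split /=; apply: ler_prod => u _.
  by rewrite ler0n mulfVK ?lexx // pnatr_eq0 -lt0n.
exists G; split=> // c f cC fG; have := Gav c f cC fG.
by rewrite negb_forall => /existsP.
Qed.

End RelativeSize.

Section Chains.
Variables (m n : nat) (pins : {set 'I_m}) (K : {set 'I_n} -> {set 'I_n}).

Definition verts (s : seq ('I_m * 'I_n)) : {set 'I_n} := [set i in map snd s].

(** A chain prescribes the positions of rows in pins one after the other, each new
    vertex lying in the kernel K of the set of the vertices before it.  The most recent
    pair is at the head of the list. *)
Fixpoint chains (j : nat) : seq (seq ('I_m * 'I_n)) :=
  if j is j'.+1 then
    [seq p :: s | s <- chains j', p <- enum (finset.setX pins (K (verts s)))]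
  else [:: [::]].

Lemma size_chains b k j : (#|pins| <= b)%N -> (forall P, #|K P| <= k)%N ->
  (size (chains j) <= (b * k) ^ j)%N.
Proof.
move=> pb Kk; elim: j => //= j IH.
rewrite size_allpairs_dep expnSr; apply: (@leq_trans (size (chains j) * (b * k))).
  elim: (chains j) => //= s ss IHs; rewrite mulSn leq_add //.
  by rewrite -cardE cardsX leq_mul.
by rewrite leq_mul2r IH orbT.
Qed.

Lemma mem_chains_size j s : s \in chains j -> size s = j.
Proof.
elim: j s => [|j IH] s /=; first by rewrite inE => /eqP->.
by move=> /allpairsPdep[s' [p [/IH <- _ ->]]].
Qed.

Definition chain_cube (s : seq ('I_m * 'I_n)) : {ffun 'I_m -> {set 'I_n}} :=
  [ffun u => [set i | all (fun p => (p.1 == u) ==> (p.2 == i)) s]].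

Lemma card_chain_cube s u : u \in map fst s -> (#|chain_cube s u| <= 1)%N.
Proof.
move=> /mapP[p ps ->]; rewrite -(cards1 p.2); apply: subset_leq_card.
apply/fintype.subsetP => i; rewrite ffunE !inE => /allP/(_ _ ps).
by rewrite eqxx /= eq_sym.
Qed.

Lemma rel_size_chain_cube (R : realFieldType) (D : 'I_m -> nat) (a : R) s :
  (forall u, 0 < D u)%N -> (forall u, (D u)%:R^-1 <= a) ->
  uniq (map fst s) -> rel_size R D (chain_cube s) <= a ^+ size s.
Proof.
move=> D0 Da us.
have -> : size s = #|[set:: map fst s]|%SET.
  by rewrite cardsE (card_uniqP us) size_map.
apply: rel_size_le_exp => // u; rewrite inE => us'.
apply: le_trans (Da u); rewrite ler_pdivrMr ?ltr0n // mulVf ?pnatr_eq0 -?lt0n //.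
by rewrite (ler_nat _ _ 1) geq_min card_chain_cube.
Qed.

Lemma in_chain_cube (f : {ffun 'I_m -> 'I_n}) s :
  all (fun p => f p.1 == p.2) s -> forall u, f u \in chain_cube s u.
Proof.
move=> /allP H u; rewrite ffunE inE; apply/allP => p /H /eqP <-.
by apply/implyP => /eqP ->.
Qed.

Lemma chain_fst_uniq (f : {ffun 'I_m -> 'I_n}) s :
  all (fun p => f p.1 == p.2) s -> uniq (map snd s) -> uniq (map fst s).
Proof.
move=> /allP H us; have E : map snd s = map f (map fst s).
  by rewrite -map_comp; apply/eq_in_map => p /H /eqP <-.
by move: us; rewrite E; apply: map_uniq.
Qed.

End Chains.

(** * The contradiction, for many colours and for few colours *)

Section Contradiction.
Variables (R : realFieldType) (n omega xi : nat).
Local Notation var := (var n omega xi).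
Local Notation cls := (clause var).
Local Notation coloring := {ffun 'I_n -> 'I_xi}.
Local Notation placement := {ffun 'I_omega -> 'I_n}.
Implicit Types (C E : cls) (chi : coloring) (f : placement) (X Y : {set 'I_n}).

Definition box C : {ffun 'I_omega -> {set 'I_n}} := [ffun u => places C u].

Variables (Delta : {set cls}) (pi DU : seq cls).
Hypothesis pi_refutes :
  resolution_refutation (clique n omega xi :|: color n omega xi :|: Delta)%SET pi.
Variables (E0 : {set coloring}).
(** The added clauses are of three kinds: those falsified only by colourings from E0, which
    are put into the set bad from the start; those of DU, whose boxes are avoided; and
    those that no placement falsifies. *)
Hypothesis Delta_split : forall C, C \in pi -> C \in Delta ->
  [\/ forall chi, color_false C chi -> chi \in E0, C \in DU |
      exists u, places C u = finset.set0].

Variables (D : 'I_omega -> nat) (T b r : nat).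
Hypothesis xi_gt0 : (0 < xi)%N.
Hypothesis D_gt0 : forall u, (0 < D u)%N.
Hypothesis DT_gt1 : forall u, (1 < D u + T)%N.
Hypothesis DT_len : forall u, (D u + T <= n)%N.

Local Notation pinned := (pinned D T).

(** Every colouring falsifies the empty clause and is injective on the empty set, and bad
    does not contain all colourings. *)
Lemma root_not_nogood (bad : {set coloring}) B :
  (2 ^ r * #|bad| <= 2 ^ r * #|E0| + size pi * n.+1 ^ B * xi ^ n)%N ->
  (2 ^ r * #|E0| + size pi * n.+1 ^ B * xi ^ n < 2 ^ r * xi ^ n)%N ->
  ~~ nogood bad (empty_clause var) finset.set0.
Proof.
move=> le lt; apply/negP => H; have := leq_ltn_trans le lt.
rewrite ltn_pmul2l ?expn_gt0 //; apply/negP; rewrite -leqNgt.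
have -> : (xi ^ n = #|[set: coloring]%SET|)%N by rewrite cardsT card_ffun !card_ord.
apply: subset_leq_card.
apply: fintype.subset_trans H; apply/fintype.subsetP => chi _.
rewrite inE; apply/andP; split.
  by apply/forall_inP => l; rewrite inE.
by apply/rainbowP => i j; rewrite inE.
Qed.

(** When 2 (b + 1) <= xi, giving one more vertex a colour different from those of b vertices
    succeeds with probability at least 1/2, so single vertices can be plucked from the sets
    occupied by the pinned rows; dead can be taken to mean nogood. *)
Theorem dense_contradiction :
  (2 * b.+1 <= xi)%N -> (1 < b)%N -> (b + r <= T)%N ->
  (2 ^ r * #|E0| + size pi * n.+1 ^ b * xi ^ n < 2 ^ r * xi ^ n)%N ->
  \sum_(C <- pi | (b < #|pinned C|)%N) rel_size R D (box C) +
    \sum_(C <- DU) rel_size R D (box C) < 1 -> False.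
Proof.
move=> bxi b1 brT small relsmall.
have [bad [E0bad sbad satbad]] := saturate pi E0 b r.
pose cs := [seq box C | C <- pi & (b < #|pinned C|)%N] ++ [seq box C | C <- DU].
have [||G [G0 Gav Gl]] := @avoidance R _ _ D D_gt0 cs.
- by move=> u; apply: leq_trans (DT_len u); apply: leq_addr.
- by rewrite big_cat !big_map big_filter.
pose Dead C X := nogood bad C X : Prop.
pose ok C X := (#|X| <= b)%N /\ C \in pi.
suff /(negP (root_not_nogood sbad small)) : Dead (empty_clause var) finset.set0 by [].
apply: (@Dead_root n omega xi Delta pi pi_refutes D T r G Dead ok) => //.
- move=> C f Cpi fG fC; split=> //.
  apply: leq_trans (leq_imset_card _ _) _; rewrite leqNgt; apply/negP => big.
  have [|u] := Gav (box C) f _ fG; last by rewrite ffunE fC.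
  by rewrite mem_cat map_f // mem_filter big.
- by move=> C X [Xb _]; apply: leq_trans brT; rewrite leq_add2r.
- move=> C Cpi CD; have [H|H|[u0 H]] := Delta_split Cpi CD.
  + left=> X; apply/fintype.subsetP => chi; rewrite inE => /andP[/H cE _].
    by apply: (fintype.subsetP E0bad).
  + right=> f fG; have [|u] := Gav (box C) f _ fG.
      by rewrite mem_cat (map_f _ H) orbT.
    by rewrite ffunE => ?; exists u.
  + by right=> f _; exists u0; rewrite H inE.
- by move=> C H X; apply: nogood_never.
- by move=> C i j; apply: nogood_pair.
- by move=> C X Y; apply: nogoodS.
- by move=> C E X; apply: nogoodW.
- by move=> C0 C1 E X _ _; apply: nogoodV.
move=> E X Epi [Xb _] /negP ndead; exists [set i | nogood bad E (i |: X)]%SET.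
split=> [|i dead]; last by rewrite inE.
by apply: (few_nogood_extensions satbad xi_gt0 Epi _ bxi Xb ndead).
Qed.

(** With few colours plucking only applies to sets of size l ~ sqrt xi, while the
    pinned rows occupy up to b vertices.  Here X is dead when it has a nogood subset of at
    most l elements.  The resolution step for p and r needs that the union of two nogood
    subsets, of size up to 2l, contains a dead set.  This is clear if X misses the kernel of
    some P inside X that is not nogood, for then two such subsets cannot exist
    at all.  Otherwise each set P that is not nogood can be extended by a vertex of its
    kernel inside X, starting from the empty set, and this yields a chain of length l along f,
    unless a nogood set, which makes X dead, is met.  The boxes of the chains are
    among those avoided by f. *)
Theorem sparse_contradiction (l : nat) (a : R) :
  (12 * l ^ 2 <= xi)%N -> (1 < l)%N -> (b + r * l.*2 <= T)%N ->
  0 <= a -> (forall u, (D u)%:R^-1 <= a) ->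
  (2 ^ r * #|E0| + size pi * n.+1 ^ l * xi ^ n < 2 ^ r * xi ^ n)%N ->
  \sum_(C <- pi | (b < #|pinned C|)%N) rel_size R D (box C) +
    \sum_(C <- DU) rel_size R D (box C) +
    (size pi * (b * (r * l.*2)) ^ l)%:R * a ^+ l < 1 -> False.
Proof.
move=> lxi l1 brT a_ge0 Da small relsmall.
have hl : (2 * (l.*2 * (l + l.*2)) <= xi)%N.
  by apply: leq_trans lxi; rewrite -mul2n; apply/eqP; lia.
have [bad [E0bad sbad satbad]] := saturate pi E0 l r.
have /choice[K KP] : forall p : cls * {set 'I_n}, exists K : {set 'I_n},
    (#|K| <= r * l.*2)%N /\ (p.1 \in pi -> (#|p.2| <= l)%N ->
      ~~ nogood bad p.1 p.2 -> [disjoint K & p.2] /\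
      forall X, (#|X| <= l.*2)%N -> nogood bad p.1 (p.2 :|: X) ->
        X :&: K != finset.set0).
  move=> [C P] /=; have [/and3P[Cpi Pl nP]|nC] :=
    boolP [&& C \in pi, (#|P| <= l)%N & ~~ nogood bad C P].
    have [K [Kr KP HK]] := kernel_of_nogood satbad xi_gt0 Cpi (leqnn _) hl Pl nP.
    by exists K.
  exists finset.set0; rewrite cards0; split=> // Cpi Pl nP.
  by move: nC; rewrite Cpi Pl nP.
(* The chains along a placement are those with distinct vertices, hence distinct rows. *)
pose ch C := [seq s <- chains (pinned C) (fun P => K (C, P)) l | uniq (map fst s)].
pose cs := [seq box C | C <- pi & (b < #|pinned C|)%N] ++ [seq box C | C <- DU] ++
  [seq chain_cube s | C <- [seq C <- pi | (#|pinned C| <= b)%N], s <- ch C].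
have [||G [G0 Gav Gl]] := @avoidance R _ _ D D_gt0 cs.
- by move=> u; apply: leq_trans (DT_len u); apply: leq_addr.
- rewrite !big_cat /= !big_map big_filter addrA; apply: le_lt_trans relsmall.
  rewrite lerD2l big_allpairs_dep /= big_filter.
  have a0 : 0 <= a ^+ l by apply: exprn_ge0.
  apply: (@le_trans _ _
    (\sum_(C <- pi | (#|pinned C| <= b)%N) ((b * (r * l.*2)) ^ l)%:R * a ^+ l)).
    apply: ler_sum => C Cb; rewrite big_seq_cond.
    apply: (@le_trans _ _ (\sum_(s <- ch C | (s \in ch C) && true) a ^+ l)).
      apply: ler_sum => s; rewrite andbT mem_filter => /andP[us /mem_chains_size <-].
      exact: rel_size_chain_cube.
    rewrite -big_seq_cond big_const_seq count_predT iter_addr_0.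
    rewrite -[_ *+ size (ch C)]mulr_natl.
    rewrite ler_wpM2r // ler_nat; apply: leq_trans (size_chains l Cb _).
      by rewrite size_filter; apply: count_size.
    by move=> P; have [] := KP (C, P).
  rewrite big_const_seq iter_addr_0 -[_ *+ count _ _]mulr_natl natrM -mulrA.
  by rewrite ler_wpM2r ?mulr_ge0 // ler_nat count_size.
pose Dead C X := exists Y, [/\ Y \subset X, (#|Y| <= l)%N & nogood bad C Y].
pose ok C X := (#|X| <= b)%N /\ (Dead C X \/ exists P : {set 'I_n},
  [/\ (#|P| <= l)%N, ~~ nogood bad C P, [disjoint K (C, P) & X] & P \subset X]).
suff [Y [Y0 _ nY]] : Dead (empty_clause var) finset.set0.
  case/negP: (root_not_nogood sbad small); move: nY.
  by move: Y0; rewrite finset.subset0 => /eqP ->.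
apply: (@Dead_root n omega xi Delta pi pi_refutes D T (r * l.*2) G Dead ok) => //.
- move=> C f Cpi fG fC; set X := (f @: _)%SET.
  have Cb : (#|pinned C| <= b)%N.
    rewrite leqNgt; apply/negP => big.
    have [|u] := Gav (box C) f _ fG; last by rewrite ffunE fC.
    by rewrite mem_cat map_f // mem_filter big.
  split; first by apply: leq_trans (leq_imset_card _ _) _.
  apply: contrapT => nok.
  suff H j : (j <= l)%N -> exists s, [/\ s \in chains (pinned C) (fun P => K (C, P)) j,
      all (fun p => f p.1 == p.2) s, uniq (map snd s) & verts s \subset X].
    have [s [sc fs us _]] := H l (leqnn l).
    have [|u] := Gav (chain_cube s) f _ fG; last first.
      by rewrite in_chain_cube.
    rewrite !mem_cat; apply/orP; right; apply/orP; right.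
    apply/allpairsPdep; exists C, s; split=> //; first by rewrite mem_filter Cb.
    by rewrite mem_filter sc (chain_fst_uniq fs us).
  elim: j => [|j IH] jl.
    exists [::]; split=> //=.
    by apply/fintype.subsetP => i; rewrite inE.
  have [s [sc fs us sX]] := IH (ltnW jl).
  have sl : (#|verts s| <= l)%N.
    rewrite cardsE; apply: leq_trans (card_size _) _.
    by rewrite size_map (mem_chains_size sc) ltnW.
  have [nP|nP] := boolP (nogood bad C (verts s)).
    by case: nok; left; exists (verts s).
  have [dK|] := boolP [disjoint K (C, verts s) & X].
    by case: nok; right; exists (verts s).
  rewrite -setI_eq0 => /set0Pn[y]; rewrite inE => /andP[yK /imsetP[u uC yE]].
  have [_ /(_ Cpi sl nP)[/= dKP _]] := KP (C, verts s).
  exists ((u, y) :: s); split=> /=.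
  + apply/allpairsPdep; exists s, (u, y); split=> //.
    by rewrite mem_enum inE /= uC.
  + by rewrite -yE eqxx.
  + rewrite us andbT; have := disjointFr dKP yK.
    by rewrite inE => ->.
  + apply/fintype.subsetP => i; rewrite inE /= inE => /orP[/eqP->|si].
      by rewrite yE imset_f.
    by apply: (fintype.subsetP sX); rewrite inE.
- by move=> C X [Xb _]; apply: leq_trans brT; rewrite leq_add2r.
- move=> C Cpi CD; have [H|H|[u0 H]] := Delta_split Cpi CD.
  + left=> X; exists finset.set0; rewrite finset.sub0set cards0; split=> //.
    apply/fintype.subsetP => chi; rewrite inE => /andP[/H cE _].
    by apply: (fintype.subsetP E0bad).
  + right=> f fG; have [|u] := Gav (box C) f _ fG.
      by rewrite !mem_cat (map_f _ H) orbT.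
    by rewrite ffunE => ?; exists u.
  + by right=> f _; exists u0; rewrite H inE.
- move=> C H X; exists finset.set0; rewrite finset.sub0set cards0; split=> //.
  exact: nogood_never.
- move=> C i j ij H; exists [set i; j]%SET; split=> //; last exact: nogood_pair.
  by rewrite cards2 ij.
- by move=> C X Y XY [Z [ZX Zl nZ]]; exists Z; split=> //; apply: fintype.subset_trans XY.
- by move=> C E X EC [Z [ZX Zl nZ]]; exists Z; split=> //; apply: nogoodW EC nZ.
- move=> C0 C1 E X Epi [_ [//|[P [Pl nP dK PX]]]] EC [Y0 [Y0X Y0l nY0]] [Y1 [Y1X Y1l nY1]].
  have [_ /(_ Epi Pl nP)[/= _ HK]] := KP (E, P).
  have nY : nogood bad E (Y0 :|: Y1)%SET.
    apply: (nogoodV EC); apply: nogoodS nY0 || apply: nogoodS nY1.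
      exact: finset.subsetUl.
    exact: finset.subsetUr.
  have /HK : (#|(Y0 :|: Y1)%SET| <= l.*2)%N.
    apply: leq_trans (leq_of_leqif (leq_card_setU _ _)) _.
    by rewrite -addnn leq_add.
  move=> /(_ (nogoodS (finset.subsetUr _ _) nY)).
  rewrite setI_eq0 => /negP[]; rewrite disjoint_sym; apply: disjointWr dK.
  by rewrite finset.subUset Y0X.
move=> E X Epi [Xb [//|[P [Pl nP dK PX]]]] ndead.
have [KE /(_ Epi Pl nP)[/= _ HK]] := KP (E, P).
exists (K (E, P)); split=> // i [Y [YX Yl nY]].
have /HK : (#|Y| <= l.*2)%N by apply: leq_trans Yl _; rewrite -addnn leq_addr.
move=> /(_ (nogoodS (finset.subsetUr _ _) nY)) /set0Pn[z].
rewrite inE => /andP[/(fintype.subsetP YX)]; rewrite in_setU1.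
by move=> /orP[/eqP-> //|zX] zK; rewrite (disjointFr dK zK) in zX.
Qed.

End Contradiction.

(** * Random degrees *)

Section Levels.
Variables (R : realType) (m n : nat).
Implicit Types (c : {ffun 'I_m -> {set 'I_n}}) (kap : {ffun 'I_m -> 'I_3}).

Section Expectation.
Variable p : 'I_3 -> R.
Hypothesis p_ge0 : forall j, 0 <= p j.
Hypothesis p_sum1 : \sum_j p j = 1.

Definition weight kap : R := \prod_u p (kap u).
Definition mean (F : {ffun 'I_m -> 'I_3} -> R) : R := \sum_kap weight kap * F kap.

Lemma weight_ge0 kap : 0 <= weight kap.
Proof. by apply: prodr_ge0. Qed.

Lemma mean_prod (phi : 'I_m -> 'I_3 -> R) :
  mean (fun kap => \prod_u phi u (kap u)) = \prod_u \sum_j p j * phi u j.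
Proof.
by rewrite bigA_distr_bigA; apply: eq_bigr => kap _; rewrite -big_split.
Qed.

Lemma mean_le (F F' : {ffun 'I_m -> 'I_3} -> R) :
  (forall kap, F kap <= F' kap) -> mean F <= mean F'.
Proof. by move=> H; apply: ler_sum => kap _; rewrite ler_wpM2l ?weight_ge0. Qed.

Lemma mean_cst a : mean (fun=> a) = a.
Proof.
rewrite /mean -mulr_suml; have := bigA_distr_bigA (fun (u : 'I_m) j => p j).
rewrite /= => <-; rewrite big1 ?mul1r // => u _; exact: p_sum1.
Qed.

Lemma mean_attained (F : {ffun 'I_m -> 'I_3} -> R) a :
  mean F <= a -> exists kap, F kap <= a.
Proof.
move=> Fa; apply: contrapT => H.
have lt kap : a < F kap by rewrite ltNge; apply/negP => le; apply: H; exists kap.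
have : mean (fun kap => F kap - a) <= 0.
  rewrite /mean; under eq_bigr do rewrite mulrBr.
  by rewrite sumrB -/(mean F) -/(mean (fun=> a)) mean_cst subr_le0.
have ge0 kap : 0 <= weight kap * (F kap - a).
  by rewrite mulr_ge0 ?weight_ge0 // subr_ge0 ltW.
move=> le0; have /eqP : mean (fun kap => F kap - a) = 0.
  by apply/eqP; rewrite eq_le le0; apply: sumr_ge0.
rewrite psumr_eq0 // => /allP H0.
have : mean (fun=> 1) = 0.
  apply: big1 => kap _; have := H0 kap (mem_index_enum _).
  by rewrite mulf_eq0 subr_eq0 (gt_eqF (lt kap)) orbF => /eqP ->; rewrite mul0r.
by rewrite mean_cst => /eqP; rewrite oner_eq0.
Qed.

(** An exponential moment of the number of u in A with level j0. *)
Lemma mean_tilt (A : {set 'I_m}) (j0 : 'I_3) (a : R) :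
  mean (fun kap => \prod_u (if (u \in A) && (kap u == j0) then a else 1)) =
  (1 + p j0 * (a - 1)) ^+ #|A|.
Proof.
rewrite (mean_prod (fun u j => if (u \in A) && (j == j0) then a else 1)).
rewrite -prodr_const [RHS]big_mkcond; apply: eq_bigr => u _.
case: (u \in A) => /=; last first.
  by rewrite -[RHS]p_sum1; apply: eq_bigr => j _; rewrite mulr1.
have := p_sum1; rewrite (bigD1 j0) //= => S1; rewrite (bigD1 j0) //= eqxx.
have -> : \sum_(j | j != j0) p j * (if j == j0 then a else 1) =
          \sum_(j | j != j0) p j.
  by apply: eq_bigr => j /negbTE->; rewrite mulr1.
have -> : \sum_(j | j != j0) p j = 1 - p j0 by rewrite -S1; ring.
ring.
Qed.

Lemma prod_tilt (A : {set 'I_m}) (j0 : 'I_3) (a : R) kap :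
  \prod_u (if (u \in A) && (kap u == j0) then a else 1) =
  a ^+ #|[set u in A | kap u == j0]|.
Proof.
by rewrite -prodr_const [RHS]big_mkcond; apply: eq_bigr => u _; rewrite inE.
Qed.

End Expectation.

(** From 1 - y <= exp(-y) and 2 <= e. *)
Lemma one_sub_pow (Q z : nat) : (0 < z)%N -> (Q <= z)%N ->
  (1 - Q%:R / z%:R) ^+ z <= (2^-1) ^+ Q :> R.
Proof.
move=> z0 Qz; have zr : (0 : R) < z%:R by rewrite ltr0n.
apply: (@le_trans _ _ (expR (- (Q%:R / z%:R)) ^+ z)).
  apply: lerXn2r; rewrite ?nnegrE ?expR_ge0 // ?expR_ge1Dx //.
  by rewrite subr_ge0 ler_pdivrMr // mul1r ler_nat.
rewrite -expRM_natr mulNr divfK ?gt_eqF // expRN -[Q%:R]mulr1 expRM_natl exprVn.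
rewrite lef_pV2 ?posrE ?exprn_gt0 ?expR_gt0 //.
by apply: lerXn2r; rewrite ?nnegrE ?expR_ge0 //; have := expR_ge1Dx (1 : R).
Qed.

(** From 1 + q <= exp q the power is at most exp(beta/4) <= (4/3)^beta, and the
    remaining factor (2/3)^beta is at most (4/9)^Q. *)
Lemma one_add_pow (beta Q N : nat) (q : R) : 0 <= q ->
  q * N%:R <= beta%:R / 4 -> (2 * Q <= beta)%N ->
  (1 + q) ^+ N / 2 ^+ beta <= (2^-1) ^+ Q :> R.
Proof.
move=> q0 qN Qb; rewrite exprVn ler_pdivrMr ?exprn_gt0 // mulrC ler_pdivlMr ?exprn_gt0 //.
have e43 : expR (4^-1) <= 4 / 3 :> R.
  have := expR_ge1Dx (- 4^-1 : R); have := expRxMexpNx_1 (4^-1 : R).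
  have := expR_gt0 (4^-1 : R); nra.
have le1 : (1 + q) ^+ N <= (4 / 3) ^+ beta.
  apply: (@le_trans _ _ (expR q ^+ N)).
    by apply: lerXn2r; rewrite ?nnegrE ?addr_ge0 ?expR_ge0 ?expR_ge1Dx.
  rewrite -expRM_natr; apply: (@le_trans _ _ (expR (beta%:R / 4))).
    by rewrite ler_expR.
  rewrite expRM_natl; apply: lerXn2r; rewrite ?nnegrE ?expR_ge0 // divr_ge0 //.
have Q2 : (0 : R) <= 2 ^+ Q by rewrite exprn_ge0.
apply: le_trans (ler_wpM2r Q2 le1) _.
have -> : (2 : R) ^+ beta = (4 / 3) ^+ beta * (3 / 2) ^+ beta.
  by rewrite -exprMn; congr (_ ^+ _); lra.
rewrite ler_wpM2l ?exprn_ge0 ?divr_ge0 //.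
apply: (@le_trans _ _ ((3 / 2) ^+ (2 * Q))).
  by rewrite exprM; apply: lerXn2r; rewrite ?nnegrE ?exprn_ge0 ?divr_ge0 //; lra.
by apply: ler_weXn2l => //; lra.
Qed.

Variables (T d0 d1 d2 : nat).
Hypothesis d2_gt0 : (0 < d2)%N.
Hypothesis d12 : (4 * (d2 + T) <= 3 * d1)%N.
Hypothesis d01 : (4 * (d1 + T) <= 3 * d0)%N.

Definition degree kap u : nat := nth 0%N [:: d0; d1; d2] (kap u).
Definition pinned_box (D : 'I_m -> nat) c : {set 'I_m} :=
  [set u | (#|c u| < D u + T)%N].

Lemma degree_gt0 kap u : (0 < degree kap u)%N.
Proof. by rewrite /degree; case: (kap u) => [[|[|[|]]]] //= _; lia. Qed.

Lemma degree_ge kap u : (d2 <= degree kap u)%N.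
Proof. by rewrite /degree; case: (kap u) => [[|[|[|]]]] //= _; lia. Qed.

Lemma degree_le kap u : (degree kap u <= d0)%N.
Proof. by rewrite /degree; case: (kap u) => [[|[|[|]]]] //= _; lia. Qed.

Let below d c : {set 'I_m} := [set u | (#|c u| < d + T)%N].
Let j0 : 'I_3 := @Ordinal 3 0 isT.
Let j1 : 'I_3 := @Ordinal 3 1 isT.

(** A row that leaves at most three quarters of its degree contributes a factor 3/4. *)
Lemma rel_size_tilt (j : 'I_3) (A : {set 'I_m}) c kap :
  (forall u, u \in A -> kap u = j ->
     (4 * #|c u| <= 3 * nth 0 [:: d0; d1; d2] j)%N) ->
  rel_size R (degree kap) c <=
    \prod_u (if (u \in A) && (kap u == j) then 3 / 4 else 1).
Proof.
move=> H; apply: rel_size_le_prod => u; case: ifP => [/andP[uA /eqP kj]|_].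
  rewrite ler_pdivrMr ?ltr0n ?degree_gt0 // -mulrA mulrC mulrAC -mulrA.
  rewrite ler_pdivlMl // -!natrM ler_nat mulnC.
  apply: leq_trans (_ : #|c u| * 4 <= _)%N; first by rewrite leq_mul2r geq_minl.
  by rewrite mulnC /degree kj; apply: H uA kj.
apply: ratio_le1; exact: degree_gt0.
Qed.

(** Choose the levels of the rows independently, level 0 with probability 4Q/z, level 1
    with probability 4Q/beta, and level 2 otherwise.  A row narrow enough to be pinned at
    level 1 (resp. 2) contributes a factor at most 3/4 whenever its level is 0 (resp. 1).
    So if at least z rows are narrow enough for level 1, then the box has expected relative
    size at most 2^-Q, thanks to the rows of level 0; and likewise if at least beta rows
    are narrow enough for level 2, thanks to those of level 1.  Otherwise more than 3 beta
    pinned rows would require more than beta rows of level 0, or more than beta rows of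
    level 1 among the fewer than z candidates, and each of these events has
    probability at most 2^-Q. *)
Theorem exists_levels (cs : seq {ffun 'I_m -> {set 'I_n}}) (beta z Q : nat) :
  (0 < Q)%N -> (8 * Q <= z)%N -> (8 * Q <= beta)%N ->
  (16 * Q * z <= beta ^ 2)%N -> (16 * Q * m <= beta * z)%N ->
  (8 * size cs <= 2 ^ Q)%N ->
  exists kap, \sum_(c <- cs | (3 * beta < #|pinned_box (degree kap) c|)%N)
     rel_size R (degree kap) c <= 4^-1.
Proof.
move=> Q0 Qz Qb zb mb sQ.
have z0 : (0 < z)%N by lia. have b0 : (0 < beta)%N by lia.
have zr : (0 : R) < z%:R by rewrite ltr0n.
have br : (0 : R) < beta%:R by rewrite ltr0n.
(* The factor 4 compensates for the loss 1 - 3/4 in [rel_size_tilt]. *)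
pose p0 : R := 4 * Q%:R / z%:R; pose p1 : R := 4 * Q%:R / beta%:R.
have p0_ge0 : 0 <= p0 by rewrite divr_ge0 ?mulr_ge0.
have p1_ge0 : 0 <= p1 by rewrite divr_ge0 ?mulr_ge0.
have p0_le : p0 <= 1 / 2.
  by rewrite /p0 ler_pdivrMr // mulrAC ler_pdivlMr // mul1r -!natrM ler_nat; lia.
have p1_le : p1 <= 1 / 2.
  by rewrite /p1 ler_pdivrMr // mulrAC ler_pdivlMr // mul1r -!natrM ler_nat; lia.
pose p (j : 'I_3) : R := nth 0 [:: p0; p1; 1 - p0 - p1] j.
have p_ge0 j : 0 <= p j by rewrite /p; case: j => [[|[|[|]]]] //= _; lra.
have p_sum1 : \sum_j p j = 1.
  by rewrite !big_ord_recr big_ord0 /p /=; lra.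
pose F c kap : R := if (3 * beta < #|pinned_box (degree kap) c|)%N
  then rel_size R (degree kap) c else 0.
pose eta : R := (2^-1) ^+ Q.
have eta0 : 0 <= eta by rewrite exprn_ge0 // invr_ge0.
suff Fc c : mean p (F c) <= 2 * eta.
  have [|kap Fk] := @mean_attained p p_ge0 p_sum1 (fun kap => \sum_(c <- cs) F c kap) 4^-1.
    rewrite /mean; under eq_bigr do rewrite mulr_sumr.
    rewrite exchange_big /=; apply: (@le_trans _ _ (\sum_(c <- cs) 2 * eta)).
      by apply: ler_sum => c _; apply: Fc.
    rewrite big_const_seq count_predT iter_addr_0 -[_ *+ size _]mulr_natl.
    have sQr : (8 * size cs)%:R <= 2 ^+ Q :> R by rewrite -natrX ler_nat.
    have etaQ : 2 ^+ Q * eta = 1 by rewrite /eta -exprMn divff ?expr1n // pnatr_eq0.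
    have := ler_wpM2r eta0 sQr; rewrite etaQ natrM.
    rewrite (_ : _ * (2 * eta) = 8 * (size cs)%:R * eta / 4); last by field.
    by rewrite ler_pdivrMr // mulVf ?pnatr_eq0.
  exists kap; apply: le_trans Fk; rewrite big_mkcond /=.
  by apply: ler_sum => c _.
have F_le_rel kap : F c kap <= rel_size R (degree kap) c.
  by rewrite /F; case: ifP => // _; apply: rel_size_ge0.
have [zL|Lz] := leqP z #|below d1 c|.
  apply: le_trans (_ : (1 + p j0 * (3 / 4 - 1)) ^+ #|below d1 c| <= _).
    rewrite -(mean_tilt p_sum1); apply: mean_le => // kap.
    apply: le_trans (F_le_rel kap) _; apply: rel_size_tilt => u.
    by rewrite inE => uL _; change (4 * #|c u| <= 3 * d0)%N; lia.
  have -> : 1 + p j0 * (3 / 4 - 1) = 1 - Q%:R / z%:R.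
    by rewrite /p /= /p0; field; rewrite gt_eqF.
  apply: (@le_trans _ _ ((1 - Q%:R / z%:R) ^+ z)).
    apply: ler_wiXn2l zL.
      by rewrite subr_ge0 ler_pdivrMr // mul1r ler_nat; lia.
    by rewrite gerBl divr_ge0.
  by apply: le_trans (one_sub_pow z0 _) _; [lia|rewrite -/eta; lra].
have [bL|Lb] := leqP beta #|below d2 c|.
  apply: le_trans (_ : (1 + p j1 * (3 / 4 - 1)) ^+ #|below d2 c| <= _).
    rewrite -(mean_tilt p_sum1); apply: mean_le => // kap.
    apply: le_trans (F_le_rel kap) _; apply: rel_size_tilt => u.
    by rewrite inE => uL _; change (4 * #|c u| <= 3 * d1)%N; lia.
  have -> : 1 + p j1 * (3 / 4 - 1) = 1 - Q%:R / beta%:R.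
    by rewrite /p /= /p1; field; rewrite gt_eqF.
  apply: (@le_trans _ _ ((1 - Q%:R / beta%:R) ^+ beta)).
    apply: ler_wiXn2l bL.
      by rewrite subr_ge0 ler_pdivrMr // mul1r ler_nat; lia.
    by rewrite gerBl divr_ge0.
  by apply: le_trans (one_sub_pow b0 _) _; [lia|rewrite -/eta; lra].
(* Markov's inequality for 2 to the number of rows of level j in A. *)
pose many j (A : {set 'I_m}) kap : R :=
  \prod_u (if (u \in A) && (kap u == j) then 2 else 1) / 2 ^+ beta.
have mean_many j (A : {set 'I_m}) : mean p (many j A) = (1 + p j) ^+ #|A| / 2 ^+ beta.
  rewrite /mean /many; under eq_bigr do rewrite mulrA.
  rewrite -mulr_suml; congr (_ / _).
  have := mean_tilt p_sum1 A j 2; rewrite /mean => ->.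
  by rewrite (_ : 2 - 1 = 1) ?mulr1 //; lra.
have many_ge j (A : {set 'I_m}) kap :
    (beta < #|[set u in A | kap u == j]|)%N -> 1 <= many j A kap.
  move=> lt; rewrite /many prod_tilt ler_pdivlMr ?exprn_gt0 // mul1r.
  by apply: ler_weXn2l; rewrite ?ler1n // ltnW.
have many_ge0 j A kap : 0 <= many j A kap.
  by rewrite /many prod_tilt divr_ge0 // exprn_ge0.
apply: (@le_trans _ _ (mean p (many j0 [set: 'I_m]%SET) + mean p (many j1 (below d1 c)))).
  rewrite /mean -big_split /=; apply: ler_sum => kap _; rewrite -mulrDr.
  rewrite ler_wpM2l ?weight_ge0 // /F; case: ifP => [lt|_]; last by rewrite addr_ge0.
  apply: (@le_trans _ _ 1).
    rewrite -(expr0 (0 : R)) -(cards0 'I_m).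
    by apply: (rel_size_le_exp (degree_gt0 kap)) => u; rewrite inE.
  have : (beta < #|[set u in [set: 'I_m]%SET | kap u == j0]|)%N ||
         (beta < #|[set u in below d1 c | kap u == j1]|)%N.
    rewrite -[_ || _]negbK negb_or -!leqNgt; apply/negP => /andP[le0 le1].
    have : pinned_box (degree kap) c \subset
      [set u in [set: 'I_m]%SET | kap u == j0] :|: [set u in below d1 c | kap u == j1]
       :|: below d2 c.
      apply/fintype.subsetP => u; rewrite !inE /degree /=.
      rewrite -!val_eqE /=.
      by case: (kap u) => [[|[|[|k]]] lt3] //= ->; rewrite ?orbT.
    move=> /subset_leq_card; have := leq_of_leqif (leq_card_setU
      ([set u in [set: 'I_m]%SET | kap u == j0] :|: [set u in below d1 c | kap u == j1])%SET
      (below d2 c)).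
    have := leq_of_leqif (leq_card_setU [set u in [set: 'I_m]%SET | kap u == j0]%SET
       [set u in below d1 c | kap u == j1]%SET).
    lia.
  case/orP => /many_ge H; first by have := many_ge0 j1 (below d1 c) kap; lra.
  by have := many_ge0 j0 [set: 'I_m]%SET kap; lra.
have -> : 2 * eta = eta + eta by lra.
have Qb2 : (2 * Q <= beta)%N by lia.
rewrite !mean_many; apply: lerD; apply: one_add_pow Qb2; rewrite ?p_ge0 //.
  rewrite cardsT card_ord /p /= /p0 mulrAC ler_pdivrMr // -mulrA -mulrA.
  have : (16 * Q * m)%:R <= (beta * z)%:R :> R by rewrite ler_nat.
  by rewrite !natrM; nra.
rewrite /p /= /p1 mulrAC ler_pdivrMr //.
have : (16 * Q * #|below d1 c|)%:R <= (beta ^ 2)%:R :> R.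
  by rewrite ler_nat; apply: leq_trans zb; rewrite leq_mul2l (ltnW Lz) orbT.
by rewrite natrX !natrM; nra.
Qed.

End Levels.

(** * Arithmetic of the parameters *)

Section Scales.
(** Here t is about n^(1/24), lam about log n, l about (xi/12)^(1/2), and w is the size
    of the clique.  The bound m^3 <= t on m = 1000 lam means that n is so
    large that all logarithmic factors are negligible against powers of t. *)
Variables (t n lam m l xi w : nat).
Hypothesis t_n : (t ^ 24 <= n)%N.
Hypothesis n_t : (n <= 2 * t ^ 24)%N.
Hypothesis lam_gt0 : (0 < lam)%N.
Hypothesis mE : m = (1000 * lam)%N.
Hypothesis m_t : (m ^ 3 <= t)%N.
Hypothesis l_xi : (12 * l ^ 2 <= xi)%N.
Hypothesis xi_l : (xi < 12 * l.+1 ^ 2)%N.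
Hypothesis l_gt1 : (1 < l)%N.
Hypothesis w_n : (w <= n)%N.
Hypothesis xi_w : (xi < w)%N.
Hypothesis w_small : (xi * w ^ 2 * lam ^ 2 <= (16 * n) ^ 2)%N.

Lemma m_ge : (1000 <= m)%N.
Proof. by clear -lam_gt0 mE; lia. Qed.
Lemma m1_t : (1000 * m <= t)%N.
Proof. by have h := m_ge; apply: leq_trans m_t; rewrite !expnS expn0; clear -h; nia. Qed.
Lemma t_le_n : (t <= n)%N.
Proof.
apply: leq_trans t_n; rewrite -{1}[t]expn1 leq_pexp2l //.
by have h := m1_t; have h' := m_ge; clear -h h'; lia.
Qed.

(** The hypothesis on w and xi < w give xi^3 lam^2 <= (16 n)^2, hence xi is
    at most about n^(2/3). *)
Lemma lam_xi_n : (32 * lam * xi <= n)%N.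
Proof.
have m1 := m_ge; have mt := m1_t.
rewrite -(@leq_exp2r _ _ 3) //.
have xi3 : (xi ^ 3 * lam ^ 2 <= (16 * n) ^ 2)%N.
  apply: leq_trans w_small; rewrite leq_mul2r; apply/orP; right.
  by rewrite expnS leq_mul2l leq_exp2r // ltnW ?orbT.
have -> : ((32 * lam * xi) ^ 3 = 32 * lam * (32 * 32) * (xi ^ 3 * lam ^ 2))%N.
  by rewrite !expnS !expn0 !muln1; move: (32%N) => c; lia.
apply: (@leq_trans (m * m * (16 * n) ^ 2)).
  by apply: leq_mul => //; nia.
rewrite [(n ^ 3)%N]expnS expnMn mulnA leq_mul2r; apply/orP; right.
apply: (leq_trans _ t_le_n); apply: (leq_trans _ m_t); rewrite !expnS !expn0 !muln1.
nia.
Qed.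

(** The critical condition is 512 Q^2 w <= beta^3.  As Q^2 ~ lam^2 xi and beta ~ xi, it
    amounts to lam^2 w <= xi^2 up to a constant.  It follows from the bound on xi w^2
    because xi^5 > t^50 exceeds n^2 ~ t^48 by a power of n. *)
Lemma dense_parameters : (t ^ 10 < xi)%N ->
  let Q := (2 * lam * l)%N in let beta := (xi %/ 12)%N in
  let b := (3 * beta)%N in let r := (lam * (l + b + 1))%N in
  [/\ (16 * Q <= beta)%N, (512 * Q ^ 2 * w <= beta ^ 3)%N,
      (2 * b.+1 <= xi)%N, (1 < b)%N & (b + r <= n %/ 16)%N].
Proof.
move=> xi_t Q beta b r.
have m1 := m_ge; have mt := m1_t; have tn := t_le_n; have lxn := lam_xi_n.
have lt : (200 * lam <= l)%N.
  rewrite leqNgt; apply/negP => ll.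
  have : (12 * l.+1 ^ 2 <= t ^ 10)%N.
    apply: (@leq_trans (t ^ 2)); last by rewrite leq_pexp2l //; lia.
    apply: (@leq_trans ((5 * l.+1) ^ 2)).
      by rewrite expnMn leq_mul2r /= ?orbT.
    by rewrite leq_exp2r //; lia.
  by lia.
have l_xi' := l_xi; rewrite !expnS expn0 muln1 in l_xi'.
have xil : (2400 * lam * l <= xi)%N by nia.
have beta_xi : (12 * beta <= xi)%N by rewrite mulnC leq_divM.
have xi_beta : (xi <= 24 * beta)%N.
  have := divn_eq xi 12; rewrite -/beta.
  have : (xi %% 12 < 12)%N by rewrite ltn_mod.
  by move: (xi %% 12)%N => rr h e; nia.
split.
- rewrite /Q; nia.
- have wxi : (3 * m ^ 2 * w <= xi ^ 2)%N.
    rewrite -(@leq_exp2r _ _ 2) //.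
    have x0 : (0 < xi * lam ^ 2)%N by rewrite muln_gt0 expn_gt0 lam_gt0 /= andbT; lia.
    rewrite -(leq_pmul2r x0).
    have -> : ((3 * m ^ 2 * w) ^ 2 * (xi * lam ^ 2) =
               (3 * m ^ 2) ^ 2 * (xi * w ^ 2 * lam ^ 2))%N.
      by rewrite expnMn; move: ((3 * m ^ 2) ^ 2)%N => c; lia.
    apply: (@leq_trans ((3 * m ^ 2) ^ 2 * (16 * n) ^ 2)); first by apply: leq_mul.
    apply: (@leq_trans ((t ^ 25) ^ 2)).
      rewrite -expnMn leq_exp2r //.
      apply: (@leq_trans (3 * m ^ 2 * (16 * (2 * t ^ 24)))); first by do 2!apply: leq_mul => //.
      rewrite expnS [X in (_ <= X)%N]expnS.
      have -> : (3 * (m * m ^ 1) * (16 * (2 * t ^ 24)) = 96 * (m * m) * t ^ 24)%N.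
        by rewrite expn1; move: (t ^ 24)%N => c; lia.
      rewrite leq_mul2r; apply/orP; right; apply: (leq_trans _ m_t).
      by rewrite !expnS expn0 muln1 leq_mul2r; apply/orP; right; lia.
    rewrite -expnM (_ : (25 * 2 = 10 * 5)%N) // expnM.
    apply: (@leq_trans (xi ^ 5)); first by rewrite leq_exp2r // ltnW.
    rewrite -expnM mulnA -expnSr leq_pmulr // expn_gt0 lam_gt0 //.
  have Q2 : (3 * Q ^ 2 <= lam ^ 2 * xi)%N.
    rewrite /Q !expnMn; apply: (@leq_trans (lam ^ 2 * (12 * l ^ 2))); first by lia.
    by rewrite leq_mul2l l_xi ?orbT.
  have h1 : (3 * (Q ^ 2 * w) <= xi * (lam ^ 2 * w))%N.
    by rewrite mulnA [(xi * _)%N]mulnA [(xi * _)%N]mulnC leq_mul2r Q2 orbT.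
  have h2 : (3 * (1000 * 1000) * (xi * (lam ^ 2 * w)) <= xi ^ 3)%N.
    rewrite [(xi ^ 3)%N]expnS mulnCA leq_mul2l; apply/orP; right.
    by apply: leq_trans wxi; rewrite mE expnMn; lia.
  have h3 : (xi ^ 3 <= 24 ^ 3 * beta ^ 3)%N by rewrite -expnMn leq_exp2r.
  rewrite -mulnA; move: h1 h2 h3.
  move: (Q ^ 2 * w)%N (xi * (lam ^ 2 * w))%N (xi ^ 3)%N (beta ^ 3)%N => x1 x2 x3 x4.
  by move=> h1 h2 h3; lia.
- rewrite /b; lia.
- rewrite /b; nia.
have hA : (lam * (12 * beta) <= lam * xi)%N by rewrite leq_mul2l beta_xi orbT.
have hB : (xi <= lam * xi)%N by rewrite leq_pmull.
have hC : (lam <= lam * l)%N by rewrite leq_pmulr //; lia.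
rewrite /r /b leq_divRL //; lia.
Qed.

(** The critical conditions are 512 Q^2 w <= beta^3 = t^36, where w <= 2 t^24 and
    Q^2 ~ lam^2 t^10, and b r l <= n / t, where b ~ t^12 and r l ~ lam t^10. *)
Lemma sparse_parameters : (xi <= t ^ 10)%N ->
  let Q := (2 * lam * l)%N in let beta := (t ^ 12)%N in
  let b := (3 * beta)%N in let r := (lam * (l + l + 1))%N in
  [/\ (16 * Q <= beta)%N, (512 * Q ^ 2 * w <= beta ^ 3)%N,
      (b + r * l.*2 <= n %/ 16)%N & (8 * (b * (r * l.*2)) * t <= n)%N].
Proof.
move=> xi_t Q beta b r.
have m1 := m_ge; have mt := m1_t.
have t0 : (0 < t)%N by clear -m1 mt; lia.
have l0 : (0 < l)%N by clear -l_gt1; lia.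
have lamt : (1000 * (1000 * lam) <= t)%N by rewrite -mE.
have l2 : (12 * l ^ 2 <= t ^ 10)%N by apply: leq_trans l_xi xi_t.
have lt : (l <= t ^ 5)%N.
  rewrite -(@leq_exp2r _ _ 2) // -expnM; apply: leq_trans l2.
  by rewrite leq_pmull.
have Q6 : (Q <= t ^ 6)%N.
  by rewrite /Q expnS; apply: leq_mul => //; clear -lamt lam_gt0; lia.
have lll : (l <= l ^ 2)%N by rewrite expnS expn1 leq_pmulr.
have rl : (r * l.*2 <= lam * t ^ 10)%N.
  rewrite /r -mulnA leq_mul2l; apply/orP; right; apply: leq_trans l2.
  by move: lll; rewrite -addnn expnS expn1 => h; clear -h; lia.
have t12 : (t ^ 12 * t ^ 11 * t <= n)%N by rewrite -expnD -expnSr.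
split.
- apply: (@leq_trans (t * t ^ 6)); first by apply: leq_mul => //; clear -lamt lam_gt0; lia.
  by rewrite -expnS leq_pexp2l.
- rewrite -expnM; apply: (@leq_trans (512 * (2 * lam * t ^ 5) ^ 2 * (2 * t ^ 24))).
    apply: leq_mul; last exact: leq_trans w_n n_t.
    rewrite leq_mul2l leq_exp2r //= /Q leq_mul2l lt ?orbT.
    by [].
  rewrite (_ : 12 * 3 = 2 + 10 + 24)%N // !expnD (expnMn (2 * lam)%N (t ^ 5)%N 2) -(expnM t 5 2).
  have : (512 * (2 * lam) ^ 2 * 2 <= t ^ 2)%N.
    apply: (@leq_trans ((64 * lam) ^ 2)); last by rewrite leq_exp2r //; clear -lamt lam_gt0; lia.
    by rewrite !expnMn; clear; lia.
  move: ((2 * lam) ^ 2)%N (t ^ 10)%N (t ^ 2)%N (t ^ 24)%N => q x y v.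
  by move=> h; have := leq_mul h (leqnn (x * v)); clear; lia.
- rewrite leq_divRL //.
  have : (lam * t ^ 10 <= t ^ 12)%N.
    rewrite (_ : 12 = 1 + 11)%N // expnD expn1; apply: leq_mul; first by clear -lamt lam_gt0; lia.
    by rewrite leq_pexp2l.
  have : (64 * t ^ 12 <= n)%N.
    apply: leq_trans t_n; rewrite (_ : 24 = 12 + 12)%N // expnD leq_mul2r.
    apply/orP; right; apply: (@leq_trans (t ^ 1)); first by rewrite expn1; clear -lamt lam_gt0; lia.
    by rewrite leq_pexp2l.
  rewrite /b /beta; move: rl; move: (r * _)%N (t ^ 12)%N (lam * _)%N => x y v.
  by clear; move=> h1 h2 h3; lia.
apply: leq_trans t12; rewrite leq_mul2r; apply/orP; right; rewrite /b /beta.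
apply: (@leq_trans (8 * (3 * t ^ 12 * (lam * t ^ 10)))).
  by rewrite leq_mul2l leq_mul2l rl !orbT.
rewrite [(t ^ 11)%N]expnS.
have : (24 * lam <= t)%N by clear -lamt lam_gt0; lia.
move=> h; have := leq_mul h (leqnn (t ^ 12 * t ^ 10)).
by move: (t ^ 12)%N (t ^ 10)%N => x y; clear; lia.
Qed.

End Scales.

(** * Refutations of size less than the power n^(l/48) *)

(** The value of z is forced by the second inequality; then the third one
    becomes the hypothesis on w. *)
Lemma level_conditions (beta Q w : nat) : (0 < Q)%N -> (16 * Q <= beta)%N ->
  (512 * Q ^ 2 * w <= beta ^ 3)%N ->
  let z := (beta ^ 2 %/ (16 * Q))%N in
  [/\ (8 * Q <= z)%N, (16 * Q * z <= beta ^ 2)%N & (16 * Q * w <= beta * z)%N].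
Proof.
move=> Q0 Qb wb z.
have Qz : (16 * Q * z <= beta ^ 2)%N by rewrite mulnC leq_divM.
have zlow : (beta ^ 2 <= 32 * Q * z)%N.
  have := divn_eq (beta ^ 2) (16 * Q); rewrite -/z.
  have : (beta ^ 2 %% (16 * Q) < 16 * Q)%N by rewrite ltn_mod; lia.
  have : (0 < z)%N by rewrite divn_gt0; nia.
  move: (beta ^ 2 %% _)%N => rr; nia.
split=> //; first by nia.
have : (512 * Q ^ 2 * w <= 32 * Q * (beta * z))%N.
  by apply: leq_trans wb _; rewrite expnS; nia.
by rewrite expnS expn1 => h; rewrite -(@leq_pmul2l (32 * Q)); nia.
Qed.

Section ShortRefutation.
Variables (R : realType) (n omega xi : nat).
Local Notation var := (var n omega xi).
Local Notation cls := (clause var).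
Local Notation coloring := {ffun 'I_n -> 'I_xi}.

(** In these rows a falsifying placement is unique. *)
Definition negrows (C : cls) : {set 'I_omega} :=
  [set u | [exists i, neg (qvar xi u i) \in C]].

Variables (Delta : {set cls}) (pi DU : seq cls) (E0 : {set coloring}).
Hypothesis pi_refutes :
  resolution_refutation (clique n omega xi :|: color n omega xi :|: Delta)%SET pi.
Hypothesis Delta_split : forall C, C \in pi -> C \in Delta ->
  [\/ forall chi, color_false C chi -> chi \in E0, C \in DU |
      exists u, places C u = finset.set0].
Hypothesis E0_small : (#|E0| + xi ^ n.-1 <= xi ^ n)%N.
Hypothesis DU_small : \sum_(C <- DU) (8 / n%:R) ^+ #|negrows C| <= 1 / 2 :> R.

Variables (t lam m l : nat).
Hypothesis t_n : (t ^ 24 <= n)%N.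
Hypothesis n_t : (n <= 2 * t ^ 24)%N.
Hypothesis n_lam : (n < 2 ^ lam)%N.
Hypothesis lam_gt0 : (0 < lam)%N.
Hypothesis mE : m = (1000 * lam)%N.
Hypothesis m_t : (m ^ 3 <= t)%N.
Hypothesis l_xi : (12 * l ^ 2 <= xi)%N.
Hypothesis xi_l : (xi < 12 * l.+1 ^ 2)%N.
Hypothesis l_gt1 : (1 < l)%N.
Hypothesis omega_n : (omega <= n)%N.
Hypothesis xi_omega : (xi < omega)%N.
Hypothesis omega_small : (xi * omega ^ 2 * lam ^ 2 <= (16 * n) ^ 2)%N.
Hypothesis pi_small : (size pi ^ 48 < n ^ l)%N.

Let k := size pi.
Let T := (n %/ 16)%N.
Let d0 := (n - T)%N.
Let d1 := (n %/ 2)%N.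
Let d2 := (n %/ 4)%N.
Let Q := (2 * lam * l)%N.

Lemma places_negrow (C : cls) u : u \in negrows C -> (#|places C u| <= 1)%N.
Proof.
rewrite inE => /existsP[i lC]; rewrite -(cards1 i); apply: subset_leq_card.
apply/fintype.subsetP => j; rewrite !inE => /forall_inP/(_ _ lC) /=.
by rewrite eqxx eqbF_neg negbK eq_sym.
Qed.

Lemma n_ge : (1000 <= n)%N.
Proof.
have h1 := m_ge lam_gt0 mE; have h2 := t_le_n t_n lam_gt0 mE m_t.
by have h3 := m1_t lam_gt0 mE m_t; clear -h1 h2 h3; lia.
Qed.

Lemma k_lt : (k < 2 ^ (lam * l))%N.
Proof.
have : (k ^ 48 < (2 ^ (lam * l)) ^ 48)%N.
  apply: leq_trans pi_small _; rewrite expnM.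
  apply: (@leq_trans ((2 ^ lam) ^ l)); first by rewrite leq_exp2r // ltnW.
  by rewrite -{1}[((2 ^ lam) ^ l)%N]expn1 leq_pexp2l // !expn_gt0.
by rewrite ltn_exp2r.
Qed.

Lemma eight_k : (8 * k <= 2 ^ Q)%N.
Proof.
rewrite /Q mulnC; apply: (@leq_trans (2 ^ (lam * l + 3))).
  by rewrite expnD leq_mul // ltnW // k_lt.
rewrite leq_exp2l // -mulnA mul2n -addnn leq_add2l (@leq_trans 4) //.
apply: (@leq_mul 2 2) => //; rewrite ltn_neqAle lam_gt0 andbT.
apply: contraTneq n_lam => <-; rewrite -leqNgt; apply: leq_trans n_ge.
by rewrite expn1.
Qed.

Lemma eight_k_t : (8 * k <= t ^ l)%N.
Proof.
have t16 : (16 <= t)%N.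
  by have h1 := m_ge lam_gt0 mE; have h2 := m1_t lam_gt0 mE m_t; clear -h1 h2; lia.
suff : ((8 * k) ^ 48 <= (t ^ l) ^ 48)%N by rewrite leq_exp2r.
rewrite expnMn; apply: (@leq_trans (8 ^ (24 * l) * (2 * t ^ 24) ^ l)).
  apply: leq_mul.
    by rewrite leq_exp2l // (_ : 48 = 24 * 2)%N // leq_mul2l l_gt1 orbT.
  apply: ltnW; apply: leq_trans pi_small _.
  by rewrite leq_exp2r // ltnW.
rewrite expnM -expnMn (_ : (t ^ l) ^ 48 = (t ^ 48) ^ l)%N; last by rewrite -!expnM mulnC.
rewrite leq_exp2r ?(ltnW l_gt1) // mulnA (_ : 48 = 24 + 24)%N // expnD leq_mul2r.
apply/orP; right; apply: (@leq_trans (16 ^ 24)); last by rewrite leq_exp2r.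
rewrite -[16%N]/(8 * 2)%N (expnMn 8 2 24) leq_mul2l; apply/orP; right.
by rewrite -{1}[2%N]expn1 leq_pexp2l.
Qed.

(** The set bad has at most #|E0| colourings and a fraction k (n+1)^B / 2^r added
    by saturation; the choice of r makes the latter smaller than 1/xi, and at least that
    fraction is left outside E0. *)
Lemma bound_E0 (B r : nat) : r = (lam * (l + B + 1))%N ->
  (2 ^ r * #|E0| + k * n.+1 ^ B * xi ^ n < 2 ^ r * xi ^ n)%N.
Proof.
move=> {r}->; set r := (lam * _)%N.
have x0 : (0 < xi)%N by apply: leq_trans l_xi; rewrite muln_gt0 expn_gt0 (ltnW l_gt1).
have xn : (xi <= n)%N by apply: leq_trans omega_n; apply: ltnW.
have nE : n = n.-1.+1 by rewrite prednK // (leq_trans _ xn).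
have kB : (k * n.+1 ^ B * xi < 2 ^ r)%N.
  have -> : (2 ^ r = 2 ^ (lam * l) * (2 ^ lam) ^ B * 2 ^ lam)%N.
    by rewrite -expnM -!expnD /r; congr (2 ^ _)%N; rewrite !mulnDr muln1.
  apply: (@leq_ltn_trans (k * (2 ^ lam) ^ B * 2 ^ lam)%N).
    apply: leq_mul; last by apply: ltnW; apply: leq_ltn_trans n_lam.
    by apply: leq_mul => //; case: (B) => // B'; rewrite leq_exp2r.
  by rewrite !ltn_pmul2r ?expn_gt0 // k_lt.
have : (2 ^ r * (#|E0| + xi ^ n.-1) <= 2 ^ r * xi ^ n)%N by rewrite leq_mul2l E0_small orbT.
rewrite mulnDr; apply: leq_trans.
rewrite -addnS leq_add2l [in (xi ^ n)%N]nE expnS mulnA.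
by rewrite ltn_pmul2r ?expn_gt0 ?x0.
Qed.

Lemma inv_degree kap (u : 'I_omega) : ((degree d0 d1 d2 kap u)%:R)^-1 <= 8 / n%:R :> R.
Proof.
have ng := n_ge; have n0 : (0 : R) < n%:R by rewrite ltr0n; clear -ng; lia.
have dg : (n <= 8 * degree d0 d1 d2 kap u)%N.
  have : (d2 <= degree d0 d1 d2 kap u)%N.
    by apply: (degree_ge (T := T)); rewrite /d0 /d1 /d2 /T; clear -ng; lia.
  by rewrite /d2; move: (degree _ _ _ _ _) => d; clear -ng; lia.
have d0' : (0 < degree d0 d1 d2 kap u)%N by move: dg; move: (degree _ _ _ _ _) => d; clear -ng; lia.
rewrite ler_pdivlMr // mulrC ler_pdivrMr ?ltr0n // -natrM ler_nat.
exact: dg.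
Qed.

Lemma DU_rel kap :
  \sum_(C <- DU) rel_size R (degree d0 d1 d2 kap) (box C) <= 1 / 2.
Proof.
have ng := n_ge; apply: le_trans DU_small; apply: ler_sum => C _.
have Dgt0 (u : 'I_omega) : (0 < degree d0 d1 d2 kap u)%N.
  by apply: (degree_gt0 (T := T)); rewrite /d0 /d1 /d2 /T; clear -ng; lia.
apply: rel_size_le_exp => // u uC; apply: le_trans (inv_degree kap u).
rewrite ler_pdivrMr ?ltr0n // mulVf ?pnatr_eq0 -?lt0n //.
by rewrite (ler_nat _ _ 1) geq_min ffunE places_negrow.
Qed.

(** The relative sizes of the avoided boxes sum to less than 1: at most 1/4 for the clauses
    with many pinned rows, 1/2 for the added clauses, and 1/8 for the chains. *)
Theorem no_short_refutation : False.
Proof.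
have ng := n_ge.
have d2_gt0 : (0 < d2)%N by rewrite /d2; clear -ng; lia.
have d12 : (4 * (d2 + T) <= 3 * d1)%N by rewrite /d1 /d2 /T; clear -ng; lia.
have d01 : (4 * (d1 + T) <= 3 * d0)%N by rewrite /d0 /d1 /d2 /T; clear -ng; lia.
have x0 : (0 < xi)%N by apply: leq_trans l_xi; rewrite muln_gt0 expn_gt0 (ltnW l_gt1).
have Dgt0 kap (u : 'I_omega) := degree_gt0 d2_gt0 d12 d01 kap u.
have Dge kap (u : 'I_omega) := degree_ge d2_gt0 d12 d01 kap u.
have Dle kap (u : 'I_omega) := degree_le d2_gt0 d12 d01 kap u.
have DTn kap (u : 'I_omega) : (degree d0 d1 d2 kap u + T <= n)%N.
  by have := Dle kap u; rewrite /d0 /T; move: (degree _ _ _ _ _) => d; clear; lia.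
have DT1 kap (u : 'I_omega) : (1 < degree d0 d1 d2 kap u + T)%N.
  by have := Dge kap u; rewrite /d2; move: (degree _ _ _ _ _) => d; clear -ng; lia.
have Q0 : (0 < Q)%N by rewrite /Q !muln_gt0 lam_gt0 (ltnW l_gt1).
have levels beta : (16 * Q <= beta)%N -> (512 * Q ^ 2 * omega <= beta ^ 3)%N ->
   exists kap : {ffun 'I_omega -> 'I_3},
     \sum_(C <- pi | (3 * beta < #|pinned (degree d0 d1 d2 kap) T C|)%N)
       rel_size R (degree d0 d1 d2 kap) (box C) <= 4^-1.
  move=> Qb wb; have [Qz zb mb] := level_conditions Q0 Qb wb.
  have Qb' : (8 * Q <= beta)%N by apply: leq_trans Qb; rewrite leq_mul2r orbT.
  have kQ : (8 * size [seq box C | C <- pi] <= 2 ^ Q)%N by rewrite size_map eight_k.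
  have [kap le] := @exists_levels R _ _ T d0 d1 d2 d2_gt0 d12 d01 _ _ _ _ Q0 Qz Qb' zb mb kQ.
  exists kap; apply: le_trans le; rewrite big_map le_eqVlt; apply/orP; left.
  apply/eqP; apply: eq_bigl => C; congr (_ < #|pred_of_set _|)%N.
  by apply/finset.setP => u; rewrite !inE ffunE.
have [xi_t|t_xi] := leqP xi (t ^ 10).
  have [Qb wb bT chain] := sparse_parameters t_n n_t lam_gt0 mE m_t l_xi l_gt1 omega_n xi_t.
  have [kap heavy] := levels _ Qb wb.
  apply: (@sparse_contradiction R n omega xi Delta pi DU pi_refutes E0 Delta_split
    _ T _ _ x0 (Dgt0 kap) (DT1 kap) (DTn kap) l (8 / n%:R) l_xi l_gt1 bT _
    (inv_degree kap) (bound_E0 erefl)); first by rewrite divr_ge0.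
  have chains_small : (size pi * (3 * t ^ 12 * (lam * (l + l + 1) * l.*2)) ^ l)%:R
     * (8 / n%:R) ^+ l <= 8^-1 :> R.
    have n0 : (0 : R) < n%:R by rewrite ltr0n; clear -ng; lia.
    rewrite expr_div_n mulrA ler_pdivrMr ?exprn_gt0 // ler_pdivlMl // -!natrX -!natrM ler_nat.
    rewrite -mulnA -expnMn mulnA; apply: (@leq_trans (t ^ l * (n %/ t) ^ l)).
      apply: leq_mul; first exact: eight_k_t.
      have t0 : (0 < t)%N.
        by have h1 := m_ge lam_gt0 mE; have h2 := m1_t lam_gt0 mE m_t; clear -h1 h2; lia.
      rewrite leq_exp2r ?(ltnW l_gt1) // leq_divRL //; apply: leq_trans chain.
      by rewrite [(_ * 8)%N]mulnC.
    by rewrite -expnMn leq_exp2r ?(ltnW l_gt1) // mulnC leq_divM.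
  have := DU_rel kap; move: heavy chains_small.
  set a1 := \sum_(_ <- pi | _) _; set a2 := \sum_(_ <- DU) _; set a3 := _ * _ ^+ l.
  by move=> h1 h2 h3; lra.
have [Qb wb bxi b1 bT] := dense_parameters t_n n_t lam_gt0 mE m_t l_xi xi_l l_gt1
  omega_n xi_omega omega_small t_xi.
have [kap heavy] := levels _ Qb wb.
apply: (@dense_contradiction R n omega xi Delta pi DU pi_refutes E0 Delta_split
    _ T _ _ x0 (Dgt0 kap) (DT1 kap) (DTn kap) bxi b1 bT (bound_E0 erefl)).
have := DU_rel kap; move: heavy.
set a1 := \sum_(_ <- pi | _) _; set a2 := \sum_(_ <- DU) _.
by move=> h1 h2; lra.
Qed.

End ShortRefutation.

(** * The bound that does not depend on the number of colours *)

Section EmptyRows.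
Variables n omega xi : nat.
Local Notation var := (var n omega xi).
Local Notation cls := (clause var).
Local Notation coloring := {ffun 'I_n -> 'I_xi}.

Definition assign (q : 'I_omega -> 'I_n -> bool) (chi : coloring) : assignment var :=
  [ffun x => truth q chi x].

Lemma falsified_premise (a : assignment var) (C F E : cls) (x : var) :
  C \subset pos x |: E -> F \subset neg x |: E ->
  ~~ sat_clause a E -> ~~ sat_clause a C \/ ~~ sat_clause a F.
Proof.
move=> /fintype.subsetP CE /fintype.subsetP FE; rewrite !negb_exists_in => /forall_inP aE.
case ax : (a x); [right|left]; apply/forall_inP => l.
  by move=> /FE; rewrite !inE => /orP[/eqP->|/aE //]; rewrite /= ax.
by move=> /CE; rewrite !inE => /orP[/eqP->|/aE //]; rewrite /= ax.
Qed.

(** When all rows are empty, only the clauses saying that some row is nonempty fail. *)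
Lemma empty_rows_falsify (chi : coloring) (C : cls) :
  C \in clique n omega xi -> ~~ sat_clause (assign (fun _ _ => false) chi) C -> #|C| = n.
Proof.
move=> Ccl; rewrite falsifiedE => /andP[/forallP H _].
have noneg u i : neg (qvar xi u i) \notin C.
  by apply/negP => lC; have /forall_inP/(_ _ lC) := H u; rewrite /= eqxx.
move: Ccl noneg; rewrite inE => /or3P[].
- move=> /existsP[u /eqP-> _]; rewrite card_imset ?card_ord // => i j [] //.
- move=> /existsP[u /existsP[v /existsP[i /andP[_ /eqP->]]]] /(_ u i).
  by rewrite !inE eqxx.
move=> /existsP[u /existsP[v /existsP[i /existsP[j /existsP[e]]]]].
by move=> /and4P[_ _ _ /eqP->] /(_ u i); rewrite !inE eqxx.
Qed.

(** Follow falsified clauses from the end of the refutation upwards, under an assignment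
    with empty rows.  The size of the clause grows by at most 1 in each step, and
    the clause reached at the top has n literals. *)
Lemma more_clauses_than_vertices (Delta : {set cls}) (pi : seq cls) (chi : coloring) :
  resolution_refutation (clique n omega xi :|: color n omega xi :|: Delta)%SET pi ->
  sat (assign (fun _ _ => false) chi) Delta -> (n < size pi)%N.
Proof.
move=> [[pi' piE] steps] /forall_inP satD; set a := assign _ _ in satD.
have H i : (i < size pi)%N -> ~~ sat_clause a (nth (empty_clause _) pi i) ->
    (n <= #|nth (empty_clause var) pi i| + i)%N.
  elim/ltn_ind: i => i IH ipi nsat; have [|[j [k [ji ki]]]] := steps i ipi.
    rewrite 2!finset.in_setU -orbA => /or3P[Ccl|Cco|CD].
    - by rewrite (empty_rows_falsify Ccl nsat) leq_addr.
    - by move: nsat; rewrite falsifiedE (negbTE (color_not_false _ Cco)) andbF.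
    - by rewrite satD in nsat.
  move=> [x [C' [F' [CE FE EE]]]].
  have [CxE FxE] := resolvent_subsets CE FE EE.
  have card_prem (A : cls) l : A \subset l |: nth (empty_clause var) pi i ->
      (#|A| <= #|nth (empty_clause var) pi i|.+1)%N.
    move=> /subset_leq_card; rewrite finset.cardsU1 => /leq_trans; apply.
    by rewrite -add1n leq_add2r leq_b1.
  have [nC|nF] := falsified_premise CxE FxE nsat.
    have := IH j ji (ltn_trans ji ipi) nC; have := card_prem _ _ CxE; lia.
  have := IH k ki (ltn_trans ki ipi) nF; have := card_prem _ _ FxE; lia.
have lt : (size pi' < size pi)%N by rewrite piE size_rcons.
have E0 : nth (empty_clause var) pi (size pi') = empty_clause var.
  by rewrite piE nth_rcons ltnn eqxx.
have := H _ lt; rewrite E0 cards0 add0n => h.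
rewrite piE size_rcons ltnS; apply: h.
by rewrite negb_exists_in; apply/forall_inP => l; rewrite inE.
Qed.

End EmptyRows.

(** * A typical sample of the random clauses *)

Section Averaging.
Variables (R : realType) (V : finType) (dT : measure_display) (T : measurableType dT)
  (P : probability T R) (delta : R) (Delta : T -> {set clause V}).
Hypothesis meas : forall a : assignment V,
  measurable ([set s | sat a (Delta s)]%classic : set T).
Hypothesis likely : forall a : assignment V,
  ((1 - delta)%:E <= P [set s | sat a (Delta s)]%classic)%E.

Lemma delta_ge0 : 0 <= delta.
Proof.
have h := le_trans (likely [ffun=> true]) (probability_le1 P (meas _)).
by rewrite lee_fin in h; lra.
Qed.

(** By linearity of the integral, the expected number of satisfied assignments among the
    A i is at least (1 - delta) #|I|; take a sample where this number is maximal. *)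
Lemma typical_sample (I : finType) (A : I -> assignment V) :
  exists s, #|[set i | ~~ sat (A i) (Delta s)]|%:R <= delta * #|I|%:R.
Proof.
pose S i := [set s | sat (A i) (Delta s)]%classic.
pose good s : nat := #|[set i | sat (A i) (Delta s)]|.
(* The sample space is not empty since its probability is 1. *)
have [s1 _] : exists s : T, True.
  apply: contrapT => noT; have T0 : [set: T]%classic = classical_sets.set0.
    by apply/seteqP; split=> // s _; case: noT; exists s.
  have := @probability_setT _ _ _ P; rewrite T0 measure0 => -[] /eqP.
  by rewrite eq_sym oner_eq0.
have exg : exists m, `[< exists s, good s = m >].
  by exists (good s1); apply/asboolP; exists s1.
have gI m : `[< exists s, good s = m >] -> (m <= #|I|)%N.
  by move=> /asboolP[s <-]; apply: max_card.
have [M /asboolP[s0 s0M] maxM] := ex_maxnP exg gI.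
exists s0.
have key : (\sum_(i : I) P (S i) <= M%:R%:E)%E.
  have -> : (\sum_(i : I) P (S i) =
     \int[P]_(s in setT) \sum_(i <- index_enum I) (\1_(S i) s)%:E)%E.
    rewrite ge0_integral_sum //.
    - by apply: eq_bigr => i _; rewrite integral_indic ?setIT //; apply: meas.
    - move=> i; apply/measurable_realfun.measurable_EFinP.
      by apply: measurable_realfun.measurable_indic; apply: meas.
  have -> : M%:R%:E = (\int[P]_(s in setT) (cst M%:R%:E s))%E.
    by rewrite integral_cst //= probability_setT mule1.
  apply: ge0_le_integral => //=.
  - by move=> s _; apply: sume_ge0 => i _; rewrite lee_fin.
  - apply: emeasurable_sum => i; apply/measurable_realfun.measurable_EFinP.
    by apply: measurable_realfun.measurable_indic; apply: meas.
  - move=> s _; rewrite sumEFin lee_fin.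
    apply: (@le_trans _ _ (good s)%:R); last first.
      by rewrite ler_nat; apply: maxM; apply/asboolP; exists s.
    rewrite /good -sum1_card natr_sum [leRHS]big_mkcond /=.
    apply: ler_sum => i _; rewrite indicE inE /S mem_setE /=.
    by rewrite (_ : (s \in _) = sat (A i) (Delta s)) ?inE //; case: ifP.
have : (\sum_(i : I) (1 - delta)%:E <= M%:R%:E)%E.
  by apply: le_trans key; apply: lee_sum => i _; apply: likely.
rewrite sumEFin lee_fin sumr_const -[_ *+ _]mulr_natl.
have : (#|[set i | ~~ sat (A i) (Delta s0)]| + M = #|I|)%N.
  rewrite -s0M /good addnC -(cardsC [set i | sat (A i) (Delta s0)]).
  by congr (_ + _)%N; apply: eq_card => i; rewrite !inE.
move=> <-; rewrite natrD => h; lra.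
Qed.

End Averaging.

(** * Sparse random rows *)

(** Bernoulli's inequality (1 - 1/y)^j >= 1 - j/y without denominators. *)
Lemma bernoulli_nat (y j : nat) : (j <= y)%N ->
  (y ^ j * (y - j) <= y * (y - 1) ^ j)%N.
Proof.
elim: j => [|j IH] jy; first by rewrite !expn0 subn0 mul1n muln1.
have h := leq_mul (IH (ltnW jy)) (leqnn (y - 1)).
apply: (@leq_trans (y ^ j * (y - j) * (y - 1))); last by rewrite expnSr mulnA.
rewrite expnSr -!mulnA leq_mul2l; apply/orP; right; clear -jy.
have [z ->] : exists z, y = (j + z.+1)%N by exists (y - j).-1; lia.
have -> : (j + z.+1 - j.+1 = z)%N by lia.
have -> : (j + z.+1 - j = z.+1)%N by lia.
have -> : (j + z.+1 - 1 = j + z)%N by lia.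
by lia.
Qed.

Lemma double_pred_pow (y j : nat) : (0 < y)%N -> (2 * j <= y)%N ->
  (y ^ j <= 2 * (y - 1) ^ j)%N.
Proof.
move=> y0 jy; have jy' : (j <= y)%N by lia.
have := bernoulli_nat jy' => h; rewrite -(@leq_pmul2l y) //.
apply: (@leq_trans (2 * (y ^ j * (y - j)))).
  by rewrite [(y * _)%N]mulnC mulnCA leq_mul2l; apply/orP; right; clear -jy; lia.
by rewrite [X in (_ <= X)%N]mulnCA leq_mul2l h orbT.
Qed.

Section Sampling.
Variables n omega xi : nat.
Local Notation var := (var n omega xi).
Local Notation cls := (clause var).
Local Notation coloring := {ffun 'I_n -> 'I_xi}.
Local Notation code := {ffun 'I_omega -> 'I_(2 * omega) * 'I_n}.
Implicit Types (z : code) (chi : coloring) (C : cls).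

(** Under a uniformly random code z the rows are independent; each is empty except with
    probability 1/(2 omega), when it has a single uniformly random vertex. *)
Definition sparse_rows z u i : bool := (val (z u).1 == 0%N) && (i == (z u).2).

Lemma row_false_ext q q' C u : (forall j, q u j = q' u j) ->
  row_false q C u = row_false q' C u.
Proof.
move=> qq; apply: eq_forallb_in => -[s [[e|[v j]]|[i c]]] //= _.
by case: eqP => //= -[->]; rewrite qq.
Qed.

(** A row with negated literals is falsified when it is nonempty and hits a
    vertex of [places C u], with probability at least 1/(2 omega n).  The other rows are
    falsified when they are empty, and all of them are empty with probability at
    least 1/2. *)
Lemma many_falsifying_codes C : (0 < n)%N -> (0 < omega)%N ->
  (forall u, places C u != finset.set0) ->
  ((2 * omega * n) ^ omega <=
   2 * (2 * omega * n) ^ #|negrows C| *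
   #|[set z | [forall u, row_false (sparse_rows z) C u]]|)%N.
Proof.
move=> n0 w0 pC.
pose ok u : {set 'I_(2 * omega) * 'I_n} :=
  [set p | row_false (fun _ i => (val p.1 == 0%N) && (i == p.2)) C u].
have -> : #|[set z | [forall u, row_false (sparse_rows z) C u]]| = (\prod_u #|ok u|)%N.
  rewrite -[RHS](_ : #|family (fun u => mem (ok u))| = _); last first.
    by rewrite card_family foldrE big_map big_enum.
  apply: eq_card => z; rewrite inE; apply: eq_forallb => u.
  by rewrite /= inE; apply: row_false_ext.
have w2 : (0 < 2 * omega)%N by rewrite muln_gt0.
have neg1 u : u \in negrows C -> (1 <= #|ok u|)%N.
  move=> _; have /set0Pn[i iC] := pC u; apply/card_gt0P.
  exists (Ordinal w2, i); by rewrite inE /=; move: iC; rewrite inE.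
have pos1 u : u \notin negrows C -> ((2 * omega - 1) * n <= #|ok u|)%N.
  rewrite inE negb_exists => /forallP nneg.
  apply: (@leq_trans #|finset.setX [set~ Ordinal w2] [set: 'I_n]|).
    by rewrite cardsX cardsC1 card_ord cardsT card_ord subn1.
  apply: subset_leq_card; apply/fintype.subsetP => -[j i].
  rewrite !inE /= andbT -val_eqE /= => /negbTE j0.
  apply/forall_inP => -[[] [[e|[v i']]|[a c]]] //= lC; rewrite j0 //=.
    by rewrite implybT.
  by apply/implyP => /eqP[vu]; have := nneg i'; rewrite -vu lC.
pose m := #|negrows C|.
have mw : (m <= omega)%N by rewrite -[X in (_ <= X)%N]card_ord max_card.
have prod_ge : (((2 * omega - 1) * n) ^ (omega - m) <= \prod_u #|ok u|)%N.
  apply: (@leq_trans (\prod_(u < omega) (if u \in negrows C then 1 else (2 * omega - 1) * n))).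
    rewrite (bigID (mem (negrows C))) /= big1 ?mul1n; last by move=> u ->.
    rewrite (eq_bigr (fun=> (2 * omega - 1) * n)%N); last by move=> u /negbTE->.
    rewrite prod_nat_const leq_eqVlt; apply/orP; left; apply/eqP; congr (_ ^ _)%N.
    rewrite /m -{1}[omega]card_ord -(cardC (mem (negrows C))) addKn.
    by apply: eq_card => u; rewrite !inE.
  by apply: leq_prod => u _; case: ifPn => [/neg1|/pos1].
apply: leq_trans
  (_ : 2 * (2 * omega * n) ^ m * ((2 * omega - 1) * n) ^ (omega - m) <= _)%N; last first.
  by rewrite leq_mul2l prod_ge orbT.
apply: (@leq_trans ((2 * omega * n) ^ m * (2 * omega * n) ^ (omega - m))).
  by rewrite -expnD subnKC.
rewrite [X in (_ <= X)%N](_ : _ = (2 * omega * n) ^ m *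
  (2 * ((2 * omega - 1) * n) ^ (omega - m)))%N; last by rewrite [RHS]mulnCA mulnA.
rewrite leq_mul2l; apply/orP; right.
rewrite (expnMn (2 * omega) n) (expnMn (2 * omega - 1) n) mulnA leq_mul2r.
apply/orP; right; apply: double_pred_pow => //.
by rewrite leq_mul2l leq_subr orbT.
Qed.

End Sampling.

(** * Boxes and colourings for the added clauses *)

Section Covers.
Variables (R : realType) (n omega xi : nat).
Local Notation var := (var n omega xi).
Local Notation cls := (clause var).
Local Notation coloring := {ffun 'I_n -> 'I_xi}.
Local Notation code := {ffun 'I_omega -> 'I_(2 * omega) * 'I_n}.
Variables (pi : seq cls) (Delta : {set cls}).

(** What [no_short_refutation] asks of the added clauses. *)
Definition handled (E0 : {set coloring}) (DU : seq cls) :=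
  [/\ forall C, C \in pi -> C \in Delta ->
        [\/ forall chi, color_false C chi -> chi \in E0, C \in DU |
            exists u, places C u = finset.set0],
      (#|E0| + xi ^ n.-1 <= xi ^ n)%N &
      \sum_(C <- DU) (8 / n%:R) ^+ #|negrows C| <= 1 / 2 :> R].

(** The lines are the classes of colourings that differ only at i; there are xi ^ n.-1
    of them. *)
Lemma card_meets_lines (i : 'I_n) (S : {set coloring}) : (0 < xi)%N ->
  (forall chi, exists c, recolor chi i c \in S) -> (xi ^ n.-1 <= #|S|)%N.
Proof.
move=> x0 H; have nE : n = n.-1.+1 by rewrite prednK // (leq_ltn_trans _ (ltn_ord i)).
rewrite -(leq_pmul2r x0) -expnSr -nE.
have -> : (xi ^ n = #|[set: coloring]%SET|)%N by rewrite cardsT card_ffun !card_ord.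
have -> : (#|S| * xi = #|finset.setX S [set: 'I_xi]%SET|)%N.
  by rewrite cardsX cardsT card_ord.
apply: leq_trans (leq_imset_card (fun p : coloring * 'I_xi => recolor p.1 i p.2) _).
apply: subset_leq_card; apply/fintype.subsetP => chi _; have [c cS] := H chi.
apply/imsetP; exists (recolor chi i c, chi i); first by rewrite !inE cS.
by apply/ffunP => j; rewrite !ffunE /=; case: eqP => // ->.
Qed.

(** A literal on p or r can be made true by recolouring one vertex, so it is true for at
    least a fraction 1/xi of the colourings. *)
Lemma color_literal_satisfiable (x : var) (b : bool) : (1 < xi)%N -> row x = None ->
  (xi ^ n.-1 <= #|[set chi : coloring | truth (fun _ _ => false) chi x == b]|)%N.
Proof.
move=> xi1; have x0 := ltnW xi1.
have other (c : 'I_xi) : exists c', c' != c.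
  have : (0 < #|[set~ c]|)%N by rewrite cardsC1 card_ord; clear -xi1; lia.
  by move=> /card_gt0P[c']; rewrite !inE; exists c'.
case: x => [[e|[u i]]|[i v]] //= _; last first.
  apply: (card_meets_lines (i := i) x0) => chi; case: b; last first.
    by have [c cv] := other v; exists c; rewrite inE ffunE eqxx (negbTE cv).
  by exists v; rewrite inE ffunE !eqxx.
have /cards2P[i [j [ij eE]]] := valP e.
have ji : (j == i) = false by rewrite eq_sym (negbTE ij).
have monoE chi c : mono (recolor chi i c) e = (c == chi j).
  apply/forall_inP/idP => [/(_ i)|/eqP-> a].
    rewrite eE !inE eqxx => /(_ isT) /forall_inP /(_ j).
    by rewrite !inE eqxx orbT !ffunE eqxx ji => /(_ isT).
  rewrite eE !inE => /orP ae; apply/forall_inP => a'; rewrite !inE => /orP ae'.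
  by case: ae => /eqP->; case: ae' => /eqP->; rewrite !ffunE ?ji ?eqxx.
apply: (card_meets_lines (i := i) x0) => chi; case: b; last first.
  by exists (chi j); rewrite inE monoE eqxx.
by have [c cv] := other (chi j); exists c; rewrite inE monoE (negbTE cv).
Qed.

(** Take a literal of the clause that is true when the rows are empty.  If it is on p or
    r, then the clause is true for at least a fraction 1/xi of the colourings, and
    the others form E0.  Otherwise it is a negated literal on q, and the box is narrow in
    its row. *)
Lemma handled_single (chi0 : coloring) : (1 < xi)%N -> (16 <= n)%N ->
  (#|Delta| <= 1)%N -> sat (assign (fun _ _ => false) chi0) Delta ->
  exists E0 DU, handled E0 DU.
Proof.
move=> xi1 n16 D1 /forall_inP satD.
have n0 : (0 < n)%N by clear -n16; lia.
have emptyE : (#|@finset.set0 coloring| + xi ^ n.-1 <= xi ^ n)%N.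
  by rewrite cards0 add0n leq_pexp2l ?leq_pred // ltnW.
have [D0|[D DD]] := set_0Vmem Delta.
  exists finset.set0, [::]; split=> //; first by move=> C _; rewrite D0 inE.
  by rewrite big_nil.
have only C : C \in Delta -> C = D.
  by move=> CD; apply: (card_le1_eqP D1).
have /exists_inP[l lD /eqP la] := satD D DD.
have [rl|[u rl]] : row l.2 = None \/ exists u, row l.2 = Some u.
  by case: (row l.2) => [u|]; [right; exists u|left].
- exists [set chi | truth (fun _ _ => false) chi l.2 != l.1], [::]; split.
  + move=> C _ /only->; constructor 1 => chi /forall_inP/(_ l lD).
    by rewrite rl eqxx inE.
  + have := color_literal_satisfiable l.1 xi1 rl; set S := [set chi | _ == _] => le.
    have -> : (xi ^ n = #|S| + #|~: S|)%N by rewrite cardsC card_ffun !card_ord.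
    rewrite addnC leq_add // leq_eqVlt; apply/orP; left; apply/eqP; apply: eq_card => chi.
    by rewrite !inE.
  + by rewrite big_nil.
exists finset.set0, [:: D]; split=> //.
  by move=> C _ /only->; constructor 2; rewrite inE.
have m1 : (0 < #|negrows D|)%N.
  apply/card_gt0P; exists u; rewrite inE; apply/existsP.
  case: l lD la rl => [b [[e|[v i]]|[i v]]] //= lD la [vu]; exists i.
  by move: la; rewrite ffunE /= => bE; rewrite -vu /neg bE.
have nr : (0 : R) < n%:R by rewrite ltr0n.
have le12 : 8 / n%:R <= 1 / 2 :> R.
  by rewrite ler_pdivrMr // mulrAC ler_pdivlMr // mul1r -natrM ler_nat.
rewrite big_seq1; apply: le_trans le12; rewrite -[leRHS]expr1.
apply: ler_wiXn2l m1; first by rewrite divr_ge0.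
by rewrite ler_pdivrMr // mul1r ler_nat; clear -n16; lia.
Qed.

(** Let E0 consist of the colourings for which more than a fraction 2 delta of the codes
    violate the added clauses; these are at most half of all colourings.  A clause that
    is falsified by a colouring outside E0 is falsified by at most a fraction 2 delta of the
    codes.  With m rows that have negated literals, this gives
    1 <= 4 delta (2 omega n)^m, so (8/n)^m is at most sqrt delta / 2 because omega
    is small against n; the hypothesis on the number of clauses bounds the sum. *)
Lemma handled_random (delta : R) : (1 < xi)%N -> (0 < omega)%N ->
  (32 * (64 * omega) <= n)%N -> 0 <= delta -> delta < 1 / 4 ->
  #|[set p : code * coloring | ~~ sat (assign (sparse_rows p.1) p.2) Delta]|%:R
    <= delta * #|{: code * coloring}|%:R ->
  #|[set C in Delta | C \in pi]|%:R * Num.sqrt delta <= 1 ->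
  exists E0 DU, handled E0 DU.
Proof.
move=> xi2 w0 wn d0 d4 typ dsqrt.
have n0 : (0 < n)%N by clear -w0 wn; lia.
have nr : (0 : R) < n%:R by rewrite ltr0n.
pose fails chi := [set z : code | ~~ sat (assign (sparse_rows z) chi) Delta].
pose E0 : {set coloring} :=
  [set chi | 2 * delta * #|{: code}|%:R < #|fails chi|%:R].
pose U : {set cls} := [set C in Delta | [&& C \in pi,
  [exists chi, color_false C chi && (chi \notin E0)] &
  [forall u, places C u != finset.set0]]].
exists E0, (enum U); split.
- move=> C Cpi CD; have [/existsP[u /eqP pu]|nex] := boolP [exists u, places C u == finset.set0].
    by constructor 3; exists u.
  have [ex|all] := boolP [exists chi, color_false C chi && (chi \notin E0)].
    constructor 2; rewrite mem_enum inE CD Cpi ex /=.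
    by apply/forallP => u; apply: contra nex => pu; apply/existsP; exists u.
  constructor 1 => chi cC; rewrite -[_ \in _]negbK; apply: contra all => nE.
  by apply/existsP; exists chi; rewrite cC.
- have sumfails : (\sum_chi #|fails chi|)%N =
    #|[set p : code * coloring | ~~ sat (assign (sparse_rows p.1) p.2) Delta]|.
    pose F (z : code) (chi : coloring) : nat :=
      if ~~ sat (assign (sparse_rows z) chi) Delta then 1 else 0.
    transitivity (\sum_(p : code * coloring) F p.1 p.2)%N.
      rewrite -(pair_bigA _ F) exchange_big /=; apply: eq_bigr => chi _.
      by rewrite -sum1_card big_mkcond /=; apply: eq_bigr => z _; rewrite !inE.
    by rewrite -sum1_card [RHS]big_mkcond /=; apply: eq_bigr => p _; rewrite !inE.
  have E2 : (2 * #|E0| <= xi ^ n)%N.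
    rewrite leqNgt; apply/negP => lt.
    have E0pos : (0 < #|E0|)%N.
      by rewrite lt0n; apply: contraTneq lt => ->; rewrite muln0.
    have : 2 * delta * #|{: code}|%:R * #|E0|%:R < (\sum_chi #|fails chi|)%:R.
      apply: (@lt_le_trans _ _ (\sum_(chi in E0) #|fails chi|%:R)).
        rewrite mulr_natr -sumr_const; apply: ltr_sum.
          move/card_gt0P: E0pos => [chi chiE]; apply/hasP; exists chi; last by [].
          by rewrite mem_index_enum.
        by move=> chi; rewrite inE.
      by rewrite natr_sum big_mkcond; apply: ler_sum => chi _; case: ifP.
    rewrite sumfails => h; have := lt_le_trans h typ.
    rewrite card_prod natrM (_ : #|{: coloring}| = xi ^ n)%N; last by rewrite card_ffun !card_ord.
    have : (xi ^ n)%:R < (2 * #|E0|)%:R :> R by rewrite ltr_nat.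
    rewrite natrM; set a := #|{: code}|%:R; set x := (xi ^ n)%:R; set e := #|E0|%:R.
    have a0 : 0 <= a by rewrite ler0n.
    move=> xe; rewrite ltNge => /negP; apply.
    rewrite (_ : 2 * delta * a * e = delta * a * (2 * e)); last by ring.
    by rewrite mulrA ler_wpM2l ?mulr_ge0 // ltW.
  have : (2 * xi ^ n.-1 <= xi ^ n)%N.
    by rewrite -[in (xi ^ n)%N](prednK n0) expnS leq_mul2r xi2 orbT.
  by clear -E2; lia.
have term C : C \in U -> (8 / n%:R) ^+ #|negrows C| <= 1 / 2 * Num.sqrt delta.
  rewrite inE => /and4P[CD Cpi /existsP[chi /andP[cC chiE]] /forallP pC].
  have sub : [set z | [forall u, row_false (sparse_rows z) C u]] \subset fails chi.
    apply/fintype.subsetP => z; rewrite !inE => rf; rewrite negb_forall_in.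
    apply/exists_inP; exists C => //; by rewrite falsifiedE rf cC.
  move: chiE; rewrite inE -leNgt => few.
  have := many_falsifying_codes n0 w0 pC; set m := #|negrows C|; set N := #|_| => many.
  have Nle : N%:R <= 2 * delta * #|{: code}|%:R.
    by apply: le_trans few; rewrite ler_nat; apply: subset_leq_card.
  have cardE : #|{: code}| = ((2 * omega * n) ^ omega)%N.
    by rewrite card_ffun card_prod !card_ord.
  have one : 1 <= 4 * delta * (2 * omega * n)%:R ^+ m.
    have W0 : 0 < ((2 * omega * n) ^ omega)%:R :> R.
      by rewrite ltr0n expn_gt0 !muln_gt0 w0 n0.
    move: Nle many W0; rewrite cardE -natrX.
    move: ((2 * omega * n) ^ omega)%N ((2 * omega * n) ^ m)%N => W Y Nle many W0.
    rewrite -(ler_pM2r W0) mul1r.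
    apply: (@le_trans _ _ (2 * Y * N)%:R); first by rewrite ler_nat.
    rewrite !natrM (_ : 4 * delta * Y%:R * W%:R = 2 * Y%:R * (2 * delta * W%:R)).
      by rewrite ler_wpM2l // mulr_ge0.
    by ring.
  have m1 : (0 < m)%N.
    by rewrite lt0n; apply: contraTneq one => ->; rewrite expr0 mulr1 -ltNge; lra.
  have small : (8 / n%:R) ^+ 2 * (2 * omega * n)%:R <= 1 / 16 :> R.
    rewrite !natrM.
    rewrite (_ : (8 / n%:R) ^+ 2 * (2 * omega%:R * n%:R) = 128 * omega%:R / n%:R);
      last by field; rewrite gt_eqF.
    have h : 32 * (64 * omega%:R) <= n%:R :> R by rewrite -!natrM ler_nat.
    rewrite ler_pdivrMr //.
    by clear -h; move: (omega%:R : R) (n%:R : R) h => o v h; lra.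
  have y0 : 0 <= (8 / n%:R : R) ^+ m by rewrite exprn_ge0 // divr_ge0.
  have s0 : 0 <= 1 / 2 * Num.sqrt delta by rewrite mulr_ge0 ?sqrtr_ge0.
  rewrite -(@ler_pXn2r _ 2) ?nnegrE // [leRHS]exprMn sqr_sqrtr //.
  have h : ((8 / n%:R : R) ^+ m) ^+ 2 * (2 * omega * n)%:R ^+ m <= 1 / 16.
    rewrite -exprM mulnC exprM -exprMn.
    apply: (@le_trans _ _ ((1 / 16) ^+ m)).
      by apply: lerXn2r; rewrite ?nnegrE // mulr_ge0 // exprn_ge0 // divr_ge0.
    rewrite -[leRHS]expr1; apply: ler_wiXn2l => //.
    by rewrite ler_pdivrMr // mul1r (ler_nat _ 1 16).
  move: one h y0; move: (_ ^+ m) ((2 * omega * n)%:R ^+ m) => y x one h y0.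
  have := ler_wpM2l (exprn_ge0 2 y0) one; rewrite mulr1 => h1.
  apply: le_trans h1 _.
  rewrite (_ : y ^+ 2 * (4 * delta * x) = 4 * delta * (y ^+ 2 * x)); last by ring.
  have := ler_wpM2l (_ : 0 <= 4 * delta) h; move=> /(_ _)/le_trans; apply.
    by rewrite mulr_ge0.
  by rewrite expr2; lra.
apply: (@le_trans _ _ (\sum_(C <- enum U) 1 / 2 * Num.sqrt delta)).
  by rewrite big_seq [leRHS]big_seq; apply: ler_sum => C; rewrite mem_enum; apply: term.
rewrite big_const_seq count_predT iter_addr_0 -cardE -[_ *+ _]mulr_natl mulrCA.
rewrite -[leRHS]mulr1 ler_wpM2l //; apply: le_trans dsqrt.
rewrite ler_wpM2r ?sqrtr_ge0 // ler_nat; apply: subset_leq_card.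
by apply/fintype.subsetP => C; rewrite !inE => /andP[-> /andP[-> _]].
Qed.

End Covers.

(** * The bound n^(c sqrt xi) *)

Lemma linear_lt_exp (e : nat) : (5 <= e)%N -> (e + 18 <= 2 ^ e)%N.
Proof.
elim: e => // e IH; rewrite leq_eqVlt => /orP[/eqP [<-] //|].
by rewrite ltnS => /IH h; rewrite expnS; clear -h; move: (2 ^ e)%N h => x; lia.
Qed.

(** With e = L / 72 it suffices that 1000 (L + 1) <= 2^e; this holds with
    room to spare as soon as e >= 22. *)
Lemma polylog_le_pow (L : nat) : (2000 <= L)%N ->
  ((1000 * L.+1) ^ 72 <= 2 ^ L)%N.
Proof.
move=> L2000; set e := (L %/ 72)%N.
have Le : (L.+1 <= 72 * e.+1)%N.
  by rewrite mulnC; apply: ltn_ceil.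
have e22 : (22 <= e)%N by rewrite leq_divRL //; apply: leq_trans L2000.
have le1 : (1000 * L.+1 <= 2 ^ e)%N.
  have le2 : (e.+1 <= 2 ^ (e - 17))%N.
    have h : (5 <= e - 17)%N by clear -e22; lia.
    by apply: leq_trans (linear_lt_exp h); clear -e22; lia.
  have -> : e = ((e - 17) + 17)%N by clear -e22; lia.
  rewrite expnD; have -> : (2 ^ 17 = 1024 * 128)%N by [].
  apply: leq_trans (_ : 1000 * (72 * e.+1) <= _)%N; first by rewrite leq_mul2l Le.
  by clear -le2; move: (2 ^ _)%N le2 => x; lia.
apply: (@leq_trans ((2 ^ e) ^ 72)%N); first by rewrite leq_exp2r.
by rewrite -expnM leq_exp2l // leq_trunc_div.
Qed.

(** t is the integer part of n^(1/24).  The exponent 72 = 3 * 24 of [polylog_le_pow] is what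
    turns m^3 > t into m^72 > n. *)
Lemma root_scale (n : nat) : let L := trunc_log 2 n in (2000 <= L)%N ->
  exists t, [/\ (t ^ 24 <= n)%N, (n <= 2 * t ^ 24)%N & ((1000 * L.+1) ^ 3 <= t)%N].
Proof.
move=> L L2000.
have n0 : (0 < n)%N.
  by case: (n) @L L2000 => // L; rewrite /L trunc_log0.
have [||t tn tmax] := @ex_maxnP (fun t => t ^ 24 <= n)%N n.
- by exists 0%N; rewrite exp0n.
- move=> j; apply: leq_trans; case: j => // j.
  by rewrite -[in leqLHS](expn1 j.+1) leq_pexp2l.
have lt : (n < t.+1 ^ 24)%N by rewrite ltnNge; apply/negP => /tmax; rewrite ltnn.
have m_t : ((1000 * L.+1) ^ 3 <= t)%N.
  rewrite leqNgt; apply/negP => tm; have le : (t.+1 ^ 24 <= n)%N.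
    apply: leq_trans (_ : ((1000 * L.+1) ^ 3) ^ 24 <= n)%N; first by rewrite leq_exp2r.
    rewrite -expnM; apply: leq_trans (polylog_le_pow L2000) _.
    exact: trunc_logP.
  by have := leq_trans lt le; rewrite ltnn.
exists t; split=> //.
have m_le : (1000 * L.+1 <= t)%N.
  by apply: leq_trans m_t; rewrite -[in leqLHS](expn1 (1000 * L.+1)) leq_pexp2l // muln_gt0.
apply: (leq_trans (ltnW lt)).
have h : (2 * 24 <= t.+1)%N by clear -m_le L2000; lia.
by have := double_pred_pow (ltn0Sn t) h; rewrite subn1.
Qed.

Lemma square_scale (x : nat) : (48 <= x)%N ->
  exists l, [/\ (12 * l ^ 2 <= x)%N, (x < 12 * l.+1 ^ 2)%N & (1 < l)%N].
Proof.
move=> x48.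
have [||l lx lmax] := @ex_maxnP (fun l => 12 * l ^ 2 <= x)%N x.
- by exists 0%N.
- by move=> j; rewrite -mulnn; clear; nia.
exists l; split=> //; last by apply: lmax.
by rewrite ltnNge; apply/negP => /lmax; rewrite ltnn.
Qed.

Section SizeBound.
Variables (R : realType) (n omega xi e : nat).
Hypothesis e_ge : (1000 <= e)%N.
Let c : R := (2^-1) ^+ e.
Hypothesis xi_n : (xi <= n)%N.
Hypothesis xi_large : 1 < c * Num.sqrt xi%:R.
Hypothesis log_bound : Num.sqrt xi%:R * omega%:R <= 8 * n%:R / log2 (n%:R : R).

Lemma sqrt_xi_gt : 2 ^+ e < Num.sqrt xi%:R :> R.
Proof.
have e0 : (0 : R) < 2 ^+ e by rewrite exprn_gt0.
by move: xi_large; rewrite /c exprVn mulrC ltr_pdivlMr // mul1r.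
Qed.

Lemma pow_lt_xi : (2 ^ (e + e) < xi)%N.
Proof.
rewrite -(ltr_nat R) natrX exprD -expr2 -[ltRHS]sqr_sqrtr //.
by rewrite ltr_pXn2r ?nnegrE ?sqrt_xi_gt ?sqrtr_ge0 // exprn_ge0.
Qed.

Lemma log_n_ge : (2000 <= trunc_log 2 n)%N.
Proof.
apply: (@leq_trans (e + e)); last first.
  by apply: trunc_log_max => //; apply: leq_trans xi_n; apply: ltnW pow_lt_xi.
by clear -e_ge; lia.
Qed.

Let L := trunc_log 2 n.

Lemma n_gt0 : (0 < n)%N.
Proof. by apply: leq_trans xi_n; apply: leq_trans pow_lt_xi. Qed.

Lemma trunc_log_le : L%:R <= log2 (n%:R : R).
Proof.
have n0 : (0 : R) < n%:R by rewrite ltr0n n_gt0.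
rewrite /log2 ler_pdivlMr ?ln_gt0 ?ltr1n // mulr_natl -lnXn // ler_ln ?posrE ?exprn_gt0 //.
by rewrite -natrX ler_nat trunc_logP // n_gt0.
Qed.

Lemma omega_log_le : Num.sqrt xi%:R * omega%:R * L%:R <= 8 * n%:R :> R.
Proof.
have L0 : (0 : R) < L%:R by rewrite ltr0n; apply: leq_trans log_n_ge.
have log0 := lt_le_trans L0 trunc_log_le.
apply: le_trans (_ : Num.sqrt xi%:R * omega%:R * log2 (n%:R : R) <= _).
  by rewrite ler_wpM2l ?trunc_log_le // mulr_ge0 ?sqrtr_ge0.
by rewrite -ler_pdivlMr.
Qed.

Lemma xi_omega_log_le : (xi * omega ^ 2 * L.+1 ^ 2 <= (16 * n) ^ 2)%N.
Proof.
rewrite -(ler_nat R) 2!natrM 3!natrX -[in leLHS](@sqr_sqrtr _ (xi%:R : R)) //.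
rewrite -!exprMn ler_pXn2r ?nnegrE ?mulr_ge0 ?sqrtr_ge0 // natrM.
have h := omega_log_le.
have le : L.+1%:R <= 2 * L%:R :> R.
  by rewrite -natrM ler_nat; move: log_n_ge; rewrite -/L; clear; lia.
apply: le_trans (_ : Num.sqrt xi%:R * omega%:R * (2 * L%:R) <= _).
  by rewrite ler_wpM2l // mulr_ge0 ?sqrtr_ge0.
by move: (_ * omega%:R) (L%:R : R) (n%:R : R) h => {le} a b v h; lra.
Qed.

Lemma omega_le_n : (32 * (64 * omega) <= n)%N.
Proof.
rewrite -(ler_nat R) !natrM.
have h : 16384 * omega%:R <= Num.sqrt xi%:R * omega%:R * L%:R :> R.
  rewrite mulrAC ler_wpM2r //.
  have s16 : 16 <= Num.sqrt xi%:R :> R.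
    apply: ltW; apply: le_lt_trans sqrt_xi_gt.
    rewrite (_ : 16 = 2 ^+ 4 :> R); last by rewrite -natrX.
    by rewrite ler_eXn2l ?ltr1n //; apply: leq_trans e_ge.
  have L2000 : 2000 <= L%:R :> R by rewrite ler_nat; exact: log_n_ge.
  have a := ler_pM (_ : 0 <= 16 :> R) (_ : 0 <= 2000 :> R) s16 L2000.
  have {}a := a (ler0n _ _) (ler0n _ _).
  by apply: le_trans a; rewrite -natrM ler_nat.
have h2 := le_trans h omega_log_le.
by move: (omega%:R : R) (n%:R : R) h2 => o v h2; lra.
Qed.

Variables (Delta : {set clause (var n omega xi)}) (pi : seq (clause (var n omega xi))).
Hypothesis omega_n : (omega <= n)%N.
Hypothesis xi_omega : (xi < omega)%N.
Hypothesis pi_refutes :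
  resolution_refutation (clique n omega xi :|: color n omega xi :|: Delta)%SET pi.

(** From k^48 >= n^l and sqrt xi <= 8 l: the constant c is far below 1/384. *)
Lemma strong_bound E0 DU : handled R pi Delta E0 DU ->
  powR n%:R (c * Num.sqrt xi%:R) <= (size pi)%:R.
Proof.
move=> [splits E0_small DU_small].
have xi48 : (48 <= xi)%N.
  apply: leq_trans (ltnW pow_lt_xi); apply: (@leq_trans (2 ^ 6)) => //.
  by rewrite leq_exp2l //; clear -e_ge; lia.
have [t [t_n n_t m_t]] := root_scale log_n_ge.
have [l [l_xi xi_l l_gt1]] := square_scale xi48.
have size_ge : (n ^ l <= size pi ^ 48)%N.
  rewrite leqNgt; apply/negP => pi_small.
  apply: (no_short_refutation pi_refutes splits E0_small DU_small t_n n_t (trunc_log_ltn n _)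
    (ltn0Sn _) (erefl _) m_t l_xi xi_l l_gt1 omega_n xi_omega xi_omega_log_le) => //.
have sqrt_le : Num.sqrt xi%:R <= 8 * l%:R :> R.
  rewrite -(@ler_pXn2r _ 2) ?nnegrE ?sqrtr_ge0 ?mulr_ge0 //.
  rewrite sqr_sqrtr // -natrM -natrX ler_nat; apply: leq_trans (ltnW xi_l) _.
  by clear -l_gt1; rewrite -!mulnn; nia.
have n1 : (1 : R) <= n%:R by rewrite ler1n n_gt0.
have n0 : (0 : R) <= n%:R by [].
have cl : c * Num.sqrt xi%:R <= l%:R / 48.
  have c512 : c <= 1 / 384.
    apply: (@le_trans _ _ ((2^-1) ^+ 9)); last first.
      by rewrite exprVn -natrX div1r lef_pV2 ?posrE // ler_nat.
    apply: ler_wiXn2l; rewrite ?invr_ge0 ?invf_le1 ?ler1n //.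
    by apply: leq_trans e_ge.
  have := ler_pM (_ : 0 <= c) (sqrtr_ge0 _) c512 sqrt_le.
  rewrite exprn_ge0 ?invr_ge0 // => /(_ isT) h.
  by apply: le_trans h _; rewrite -subr_ge0; lra.
apply: (le_trans (ler_powR n1 cl)).
rewrite -(@ler_pXn2r _ 48) ?nnegrE ?powR_ge0 //.
rewrite -(@powR_mulrn _ _ 48) ?powR_ge0 // -powRrM -mulrA mulVf ?mulr1 ?powR_mulrn //.
by rewrite -!natrX ler_nat.
Qed.

End SizeBound.

(** * The theorem *)

(* The inverse in the last inequality is the one of \bar R, with 0^-1 = +oo:
   for delta = 0 the minimum is n `^ (c * sqrt xi). *)
Theorem theorem1p1 (R : realType) :
  exists c : R, 0 < c /\
  forall (n omega xi : nat) (delta : R)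
         (dT : measure_display) (T : measurableType dT) (P : probability T R)
         (pi : T -> seq (clause (var n omega xi)))
         (Delta : T -> {set clause (var n omega xi)})
         (k d : nat),
    (omega <= n)%N -> (xi < omega)%N -> (1 <= xi)%N ->
    Num.sqrt xi%:R * omega%:R <= 8 * n%:R / log2 (n%:R : R) ->
    delta < 1 ->
    random_resolution_refutation P delta
      (clique n omega xi :|: color n omega xi)%SET pi Delta ->
    is_max (fun s : T => size (pi s)) k ->
    is_max (fun s : T => #|Delta s|) d ->
    (d%:R * delta < 1 ->
       (1 - d%:R * Num.sqrt delta) * powR n%:R (c * Num.sqrt xi%:R) <= k%:R)
    /\
    (Order.min ((2 * Num.sqrt delta)%:E^-1) (powR n%:R (c * Num.sqrt xi%:R))%:E
       <= k%:R%:E)%E.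
Proof.
have [e e_ge] : exists e, (1000 <= e)%N by exists 1000%N.
exists ((2^-1) ^+ e); split; first by rewrite exprn_gt0 // invr_gt0.
move=> n omega xi delta dT T P pi Delta k d omega_n xi_omega xi1 log_bound delta1.
case=> meas refutes likely [_ k_max] [_ d_max].
set c := _ ^+ e; set bound := powR _ _.
have bound_ge0 : 0 <= bound by rewrite powR_ge0.
have delta0 := delta_ge0 meas likely.
pose chi0 : {ffun 'I_n -> 'I_xi} := [ffun=> Ordinal xi1].
have [s0 s0_sat] : exists s, sat (assign (fun _ _ => false) chi0) (Delta s).
  have [//|none] := pselect (exists s, sat (assign (fun _ _ => false) chi0) (Delta s)).
  have := likely (assign (fun _ _ => false) chi0).
  rewrite (_ : [set s | _]%classic = classical_sets.set0).
    by rewrite measure0 lee_fin leNgt subr_gt0 delta1.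
  by apply/seteqP; split=> s //= h; case: none; exists s.
have n_k : (n < k)%N.
  by apply: leq_trans (k_max s0); apply: more_clauses_than_vertices (refutes s0) s0_sat.
have k_of_size s : bound <= (size (pi s))%:R -> bound <= k%:R.
  by move=> h; apply: (le_trans h); rewrite ler_nat.
have c_ge0 : 0 <= c by rewrite exprn_ge0 // invr_ge0.
have sqrt0 := sqrtr_ge0 delta.
have part1_of : bound <= k%:R -> (1 - d%:R * Num.sqrt delta) * bound <= k%:R.
  by apply: le_trans; rewrite -[leRHS]mul1r ler_wpM2r // lerBlDr lerDl mulr_ge0.
have part2_of : bound <= k%:R ->
    (Order.min ((2 * Num.sqrt delta)%:E^-1) bound%:E <= k%:R%:E)%E.
  by move=> h; rewrite ge_min lee_fin h orbT.
(* For bounded xi the bound to be proved is at most n. *)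
have [small|large] := leP (c * Num.sqrt xi%:R) 1.
  suff h : bound <= k%:R by split=> [_|]; [apply: part1_of|apply: part2_of].
  have n1 : 1 <= n%:R :> R.
    by rewrite ler1n (leq_trans _ omega_n) // (leq_trans _ xi_omega).
  apply: le_trans (ler_powR n1 small) _; rewrite powRr1 //.
  by rewrite ler_nat ltnW.
have xi_n : (xi <= n)%N by apply: leq_trans omega_n; apply: ltnW.
have strong s E0 DU : handled R (pi s) (Delta s) E0 DU -> bound <= k%:R.
  by move=> /(strong_bound e_ge xi_n large log_bound omega_n xi_omega (refutes s))/k_of_size.
have xi2 : (1 < xi)%N.
  by apply: leq_ltn_trans (pow_lt_xi large); rewrite expn_gt0.
have omega0 : (0 < omega)%N by apply: leq_trans xi_omega.
have omega_le := omega_le_n e_ge xi_n large log_bound.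
have n16 : (16 <= n)%N by clear -omega_le omega0; lia.
have random s : delta < 1 / 4 ->
    #|[set p | ~~ sat (assign (sparse_rows p.1) p.2) (Delta s)]|%:R <=
      delta * #|{: {ffun 'I_omega -> 'I_(2 * omega) * 'I_n} * {ffun 'I_n -> 'I_xi}}|%:R ->
    #|[set C in Delta s | C \in pi s]|%:R * Num.sqrt delta <= 1 -> bound <= k%:R.
  move=> d4 typ few.
  have [E0 [DU h]] := handled_random xi2 omega0 omega_le delta0 d4 typ few.
  exact: strong h.
have [s1 s1_typ] := typical_sample meas likely
  (fun p : {ffun 'I_omega -> 'I_(2 * omega) * 'I_n} * {ffun 'I_n -> 'I_xi} =>
     assign (sparse_rows p.1) p.2).
split.
- move=> _; have [big|less] := leP 1 (d%:R * Num.sqrt delta).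
    by apply: le_trans (ler0n _ _); rewrite mulr_le0_ge0 // subr_le0.
  (* Now d * sqrt delta < 1, so delta can be close to 1 only if d <= 1. *)
  apply: part1_of; have [d1|d2] := leqP d 1.
    have [E0 [DU h]] := handled_single R (pi s0) xi2 n16 (leq_trans (d_max s0) d1) s0_sat.
    exact: strong h.
  apply: (random s1 _ s1_typ).
    have h : 2 * Num.sqrt delta < 1.
      by apply: le_lt_trans less; rewrite ler_wpM2r // ler_nat.
    rewrite -(sqr_sqrtr delta0); move: (Num.sqrt delta) sqrt0 h => x x0 h.
    by rewrite expr2; nra.
  apply: le_trans (ltW less); rewrite ler_wpM2r // ler_nat.
  apply: leq_trans (d_max s1); apply: subset_leq_card.
  by apply/fintype.subsetP => C; rewrite !inE => /andP[].
have [le|gt] := leP ((2 * Num.sqrt delta)%:E^-1)%E k%:R%:E.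
  by rewrite ge_min le.
apply: part2_of.
have k1 : 1 <= k%:R :> R by rewrite ler1n (leq_ltn_trans _ n_k).
(* At most k of the added clauses occur in the refutation, whatever d is. *)
have less : 2 * Num.sqrt delta * k%:R < 1.
  have [->|nz] := eqVneq (Num.sqrt delta) 0; first by rewrite mulr0 mul0r.
  have pos2 : 0 < 2 * Num.sqrt delta by rewrite mulr_gt0 // lt_def nz.
  move: gt; rewrite inver gt_eqF // lte_fin => h.
  by rewrite mulrC -ltr_pdivlMr // div1r.
apply: (random s1 _ s1_typ).
  rewrite -(sqr_sqrtr delta0); move: (Num.sqrt delta) (k%:R : R) sqrt0 k1 less.
  move=> x y x0 y1 h; have : 2 * x < 1.
    by apply: le_lt_trans h; rewrite ler_peMr // mulr_ge0.
  by rewrite expr2; nra.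
have le : #|[set C in Delta s1 | C \in pi s1]|%:R <= k%:R :> R.
  rewrite ler_nat; apply: leq_trans (k_max s1); apply: leq_trans (card_size (pi s1)).
  by apply: subset_leq_card; apply/fintype.subsetP => C; rewrite !inE => /andP[].
apply: le_trans (ler_wpM2r sqrt0 le) _.
by move: (Num.sqrt delta) (k%:R : R) sqrt0 k1 less => x y x0 y1 h; nra.
Qed.
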